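(* Let $H=\langle h_1,h_2\rangle$ be a marked extension of $P$ which is left orderable. Then there exists a square root of Thompson's group $G\in\mathcal{S}$ such that $H<G$ (that is, $H$ is isomorphic to a subgroup of $G$).
   Context: Let $I=[0,1]$ and let $\mathrm{Homeo}^+(I)$ be the group of orientation-preserving homeomorphisms of $I$. For a homeomorphism $f$, $\operatorname{supp} f=\{x : f(x)\neq x\}$. Two nonempty open intervals $J_1,J_2$ form a two-chain if $J_1\cap J_2$ is a nonempty proper subinterval of $J_1$ and of $J_2$. Thompson's group is $F\cong\langle A,B\mid [A,(AB)^{-1}B(AB)],\ [A,(AB)^{-2}B(AB)^2]\rangle\cong\langle a,b\mid [ab^{-1},a^{-1}ba],\ [ab^{-1},a^{-2}ba^2]\rangle$. A square root of $F$ is a two-generated subgroup $\langle f,g\rangle<\mathrm{Homeo}^+(I)$ such that $\langle f^2,g^2\rangle\cong F$ and such that $\operatorname{supp} f$ and $\operatorname{supp} g$ are open intervals forming a two-chain. $\mathcal{S}$ denotes the set of isomorphism classes of square roots of $F$; $G\in\mathcal S$ means that $G$ is a square root of $F$. Let $F_1=\langle p_1,p_2\mid [p_1p_2^{-1},p_1^{-1}p_2p_1],[p_1p_2^{-1},p_1^{-2}p_2p_1^2]\rangle$ and $F_2=\langle q_1,q_2\mid [q_1q_2^{-1},q_1^{-1}q_2q_1],[q_1q_2^{-1},q_1^{-2}q_2q_1^2]\rangle$ be two copies of $F$. $P$ is the subgroup of $F_1\times F_2$ generated by $(p_1,q_2)$ and $(p_2,q_1)$. A group $H=\langle h_1,h_2\rangle$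 is a marked extension of $P$ if there is a surjective homomorphism $H\to P$ with $h_1\mapsto(p_1,q_2)$ and $h_2\mapsto(p_2,q_1)$. A group is left orderable if it admits a left-invariant total order; for countable groups this is equivalent to admitting a faithful action by orientation-preserving homeomorphisms of $\mathbb{R}$. *)

(* Defs.v *)
From HB Require Import structures.
From mathcomp Require Import all_boot all_order all_algebra generic_quotient.
From mathcomp Require Import all_classical all_reals all_analysis.

Set Implicit Arguments.
Unset Strict Implicit.
Unset Printing Implicit Defensive.

Import Order.TTheory GRing.Theory Num.Theory.
Import numFieldNormedType.Exports.

Local Open Scope classical_set_scope.
Local Open Scope group_scope.

Definition is_subgroup (G : groupType) (K : set G) : Prop :=
  [/\ K 1, forall x y, K x -> K y -> K (x * y) & forall x, K x -> K x^-1].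

Definition gen_subgroup (G : groupType) (S : set G) : set G :=
  smallest (@is_subgroup G) S.

(* A multiplicative map between groups automatically preserves 1 and inverses,
   so it is a group homomorphism. *)
Definition isomorphic_to_subgroup (H G : groupType) (K : set G) : Prop :=
  exists phi : {multiplicative H -> G}, injective phi /\ range phi = K.

Definition embeds_in_subgroup (H G : groupType) (K : set G) : Prop :=
  exists phi : {multiplicative H -> G}, injective phi /\ range phi `<=` K.

Definition left_orderable (G : groupType) : Prop :=
  exists le : rel G,
    [/\ antisymmetric le, transitive le, total le
      & forall x y z : G, le x y -> le (z * x) (z * y)].

Inductive gterm (T : Type) : Type :=
  | GGen of T
  | GOne
  | GMul of gterm T & gterm T
  | GInv of gterm T.

Arguments GOne {T}.

HB.instance Definition _ T := gen_eqMixin (gterm T).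
HB.instance Definition _ T := gen_choiceMixin (gterm T).
(* Formal operations satisfying no law: with them relators can be written in
   the usual group notation. *)
HB.instance Definition _ T := hasMul.Build (gterm T) (@GMul T).
HB.instance Definition _ T := hasOne.Build (gterm T) GOne.
HB.instance Definition _ T := hasInv.Build (gterm T) (@GInv T).

(* The least congruence that contains the group laws and kills the relators. *)
Inductive pres_eq (T : Type) (rels : set (gterm T)) :
    gterm T -> gterm T -> Prop :=
  | pres_refl x : pres_eq rels x x
  | pres_sym x y : pres_eq rels x y -> pres_eq rels y x
  | pres_trans y x z : pres_eq rels x y -> pres_eq rels y z -> pres_eq rels x z
  | pres_mul x x' y y' : pres_eq rels x x' -> pres_eq rels y y' ->
      pres_eq rels (x * y) (x' * y')
  | pres_inv x x' : pres_eq rels x x' -> pres_eq rels x^-1 x'^-1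
  | pres_mulA x y z : pres_eq rels (x * (y * z)) (x * y * z)
  | pres_mul1g x : pres_eq rels (1 * x) x
  | pres_mulg1 x : pres_eq rels (x * 1) x
  | pres_mulVg x : pres_eq rels (x^-1 * x) 1
  | pres_mulgV x : pres_eq rels (x * x^-1) 1
  | pres_rel r : rels r -> pres_eq rels r 1.

Section PresentedGroup.
Variables (T : Type) (rels : set (gterm T)).

Definition pres_rel_bool : rel (gterm T) := fun x y => `[< pres_eq rels x y >].

Fact pres_rel_bool_refl : reflexive pres_rel_bool.
Proof. by move=> x; apply/asboolP; apply: pres_refl. Qed.

Fact pres_rel_bool_sym : symmetric pres_rel_bool.
Proof. by move=> x y; apply/asboolP/asboolP; apply: pres_sym. Qed.

Fact pres_rel_bool_trans : transitive pres_rel_bool.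
Proof.
by move=> y x z /asboolP xy /asboolP yz; apply/asboolP; apply: pres_trans yz.
Qed.

Canonical pres_equiv :=
  EquivRel pres_rel_bool pres_rel_bool_refl pres_rel_bool_sym
           pres_rel_bool_trans.

Definition presented : Type := {eq_quot pres_equiv}%qT.

HB.instance Definition _ := Choice.on presented.

Definition pres_pi (x : gterm T) : presented := (\pi_({eq_quot pres_equiv}) x)%qT.
Definition pres_repr (u : presented) : gterm T :=
  repr (u : {eq_quot pres_equiv}%qT).

Lemma pres_piP (x y : gterm T) : pres_eq rels x y <-> pres_pi x = pres_pi y.
Proof.
split=> [xy|/eqmodP/asboolP //].
by apply/eqmodP/asboolP.
Qed.

Lemma pres_reprK : cancel pres_repr pres_pi.
Proof. by move=> u; rewrite /pres_pi /pres_repr reprK. Qed.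

Definition pres_one : presented := pres_pi 1.
Definition pres_mulg (u v : presented) : presented :=
  pres_pi (pres_repr u * pres_repr v).
Definition pres_invg (u : presented) : presented := pres_pi (pres_repr u)^-1.

Lemma pres_pi_mul x y : pres_mulg (pres_pi x) (pres_pi y) = pres_pi (x * y).
Proof. by apply/pres_piP/pres_mul; apply/pres_piP; rewrite pres_reprK. Qed.

Lemma pres_pi_inv x : pres_invg (pres_pi x) = pres_pi x^-1.
Proof. by apply/pres_piP/pres_inv/pres_piP; rewrite pres_reprK. Qed.

Fact presented_mulgA : associative pres_mulg.
Proof.
move=> u v w; rewrite -(pres_reprK u) -(pres_reprK v) -(pres_reprK w).
by rewrite !pres_pi_mul; apply/pres_piP/pres_mulA.
Qed.

Fact presented_mul1g : left_id pres_one pres_mulg.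
Proof.
by move=> u; rewrite -(pres_reprK u) pres_pi_mul; apply/pres_piP/pres_mul1g.
Qed.

Fact presented_mulg1 : right_id pres_one pres_mulg.
Proof.
by move=> u; rewrite -(pres_reprK u) pres_pi_mul; apply/pres_piP/pres_mulg1.
Qed.

Fact presented_mulVg : left_inverse pres_one pres_invg pres_mulg.
Proof.
move=> u; rewrite -(pres_reprK u) pres_pi_inv pres_pi_mul.
exact/pres_piP/pres_mulVg.
Qed.

Fact presented_mulgV : right_inverse pres_one pres_invg pres_mulg.
Proof.
move=> u; rewrite -(pres_reprK u) pres_pi_inv pres_pi_mul.
exact/pres_piP/pres_mulgV.
Qed.

HB.instance Definition _ :=
  isGroup.Build presented presented_mulgA presented_mul1g presented_mulg1
    presented_mulVg presented_mulgV.

End PresentedGroup.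

Inductive F_generator := Fgen_a | Fgen_b.

(* [x ^ y] is the conjugate [y^-1 * (x * y)]. *)
Definition F_relators : set (gterm F_generator) :=
  let a := GGen Fgen_a in let b := GGen Fgen_b in
  [set [~ a * b^-1, b ^ a]; [~ a * b^-1, b ^ (a ^+ 2)]].

Definition thompsonF : groupType := presented F_relators.
Definition F_a : thompsonF := pres_pi F_relators (GGen Fgen_a).
Definition F_b : thompsonF := pres_pi F_relators (GGen Fgen_b).

Definition groupP : set (thompsonF * thompsonF)%type :=
  gen_subgroup [set (F_a, F_b); (F_b, F_a)].

Definition marked_extension_of_P (H : groupType) (h1 h2 : H) : Prop :=
  gen_subgroup [set h1; h2] = [set: H] /\
  exists phi : {multiplicative H -> (thompsonF * thompsonF)%type},
    [/\ range phi = groupP, phi h1 = (F_a, F_b) & phi h2 = (F_b, F_a)].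

(* Carries the subspace topology inherited from R. *)
Definition unitI (R : realType) := set_type `[0%R : R, 1%R].
HB.instance Definition _ R := Topological.on (unitI R).

Record homeoI (R : realType) := HomeoI {
  homeo_fun :> unitI R -> unitI R;
  homeo_inv : unitI R -> unitI R;
  homeo_funK : cancel homeo_fun homeo_inv;
  homeo_invK : cancel homeo_inv homeo_fun;
  homeo_fun_cts : continuous homeo_fun;
  homeo_inv_cts : continuous homeo_inv;
  homeo_incr : forall x y : unitI R,
    (\val x < \val y)%R -> (\val (homeo_fun x) < \val (homeo_fun y))%R
}.

Section HomeoGroup.
Variable R : realType.

HB.instance Definition _ := gen_eqMixin (homeoI R).
HB.instance Definition _ := gen_choiceMixin (homeoI R).

Lemma homeoI_eq (f g : homeoI R) : homeo_fun f =1 homeo_fun g -> f = g.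
Proof.
case: f => f f' fK f'K cf cf' mf; case: g => g g' gK g'K cg cg' mg /= /funext fg.
rewrite -fg in gK g'K cg mg *.
have f'g' : f' = g' by apply/funext => x; rewrite -{1}(g'K x) fK.
rewrite -f'g' in gK g'K cg' *.
by congr HomeoI; apply: Prop_irrelevance.
Qed.

Definition homeoI_one : homeoI R.
Proof.
by refine (@HomeoI R id id _ _ _ _ _) => // x; exact: cvg_id.
Defined.

Definition homeoI_mul (f g : homeoI R) : homeoI R.
Proof.
refine (@HomeoI R (f \o g) (homeo_inv g \o homeo_inv f) _ _ _ _ _).
- by move=> x /=; rewrite !homeo_funK.
- by move=> x /=; rewrite !homeo_invK.
- by move=> x; apply: continuous_comp; exact: homeo_fun_cts.
- by move=> x; apply: continuous_comp; exact: homeo_inv_cts.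
- by move=> x y xy /=; do 2 apply: homeo_incr.
Defined.

Definition homeoI_inv (f : homeoI R) : homeoI R.
Proof.
refine (@HomeoI R (homeo_inv f) f (@homeo_invK _ f) (@homeo_funK _ f)
          (@homeo_inv_cts _ f) (@homeo_fun_cts _ f) _).
move=> x y xy; case: (ltrgtP (\val (homeo_inv f x)) (\val (homeo_inv f y))) => //.
- by move=> /(@homeo_incr _ f); rewrite !homeo_invK => /(lt_trans xy); rewrite ltxx.
- by move=> /val_inj /(can_inj (@homeo_invK _ f)) xy'; rewrite xy' ltxx in xy.
Defined.

Fact homeoI_mulA : associative homeoI_mul.
Proof. by move=> f g h; apply: homeoI_eq. Qed.

Fact homeoI_mul1 : left_id homeoI_one homeoI_mul.
Proof. by move=> f; apply: homeoI_eq. Qed.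

Fact homeoI_mulr1 : right_id homeoI_one homeoI_mul.
Proof. by move=> f; apply: homeoI_eq. Qed.

Fact homeoI_mulV : left_inverse homeoI_one homeoI_inv homeoI_mul.
Proof. by move=> f; apply: homeoI_eq => x /=; rewrite homeo_funK. Qed.

Fact homeoI_mulrV : right_inverse homeoI_one homeoI_inv homeoI_mul.
Proof. by move=> f; apply: homeoI_eq => x /=; rewrite homeo_invK. Qed.

HB.instance Definition _ :=
  isGroup.Build (homeoI R) homeoI_mulA homeoI_mul1 homeoI_mulr1
    homeoI_mulV homeoI_mulrV.

End HomeoGroup.

Section SquareRoot.
Variable R : realType.

(* Viewed as a subset of R; it avoids the endpoints 0 and 1, which f fixes. *)
Definition support (f : homeoI R) : set R :=
  [set \val x | x in [set x : unitI R | f x <> x]].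

Definition open_interval (J : set R) : Prop :=
  [/\ open J, is_interval J & J !=set0].

Definition two_chain (J1 J2 : set R) : Prop :=
  [/\ open_interval J1, open_interval J2,
      is_interval (J1 `&` J2) /\ J1 `&` J2 !=set0,
      J1 `&` J2 `<` J1 & J1 `&` J2 `<` J2].

Definition is_square_root_of_F (K : set (homeoI R)) : Prop :=
  exists f g : homeoI R,
    [/\ K = gen_subgroup [set f; g],
        isomorphic_to_subgroup thompsonF (gen_subgroup [set f ^+ 2; g ^+ 2])
      & two_chain (support f) (support g)].

End SquareRoot.

(* Main.v *)
(* By the dynamical realization, H acts faithfully on a small interval J of
   [0, 1]. Two homeomorphisms A, B that move points to the left on (0, beta)
   and on (alpha, 1) and satisfy A (B beta) <= alpha generate a copy of F:
   images of the normal forms of F are told apart by their action near the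
   left ends of the supports of the generators x_n. So the squares of f and
   g may be kept fixed while f is modified on a fundamental domain of f^2.
   We start from a pair f0, g0 that agree on an interval D and pick t in the
   copy of F, with support in D and with t J disjoint from J. Modifying f0
   so that g^-1 f acts on D as an arbitrary u, the group <f, g> contains [t,
   u], which can be chosen to act as h1 on J, as a conjugate of h2 on t^-1
   J, and trivially elsewhere. This element and its conjugate by t act as
   (h1, h2) on J and as (h2, 1) and (1, h1) on t^-1 J and t J; as h1, h2 are
   mapped to a basis of the abelianization of F by the first coordinate of H
   -> P, they generate a copy of H. *)

From HB Require Import structures.
Require Import Defs.
From mathcomp Require Import all_boot all_order all_algebra ring lra zify.
From mathcomp Require Import all_classical all_reals all_analysis.

Set Implicit Arguments.
Unset Strict Implicit.
Unset Printing Implicit Defensive.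

Import Order.TTheory GRing.Theory Num.Theory.
Import numFieldNormedType.Exports.

Local Open Scope classical_set_scope.
Local Open Scope ring_scope.

(** * Homeomorphisms of [0, 1] as bijections of the line *)
Section Action.
Variable R : realType.
Implicit Types (f g h : homeoI R) (x y : R).

(* Extending by the identity turns homeomorphisms of [0, 1] into bijections of
   R, so that no membership proof has to be carried along. *)
Definition act f x : R :=
  if insub x is Some u then \val (homeo_fun f u) else x.

Lemma act_val f (u : unitI R) : act f (\val u) = \val (f u).
Proof. by rewrite /act valK. Qed.

Lemma unitI_itv (u : unitI R) : 0 <= \val u <= 1.
Proof. by case: u => x p /=; move: (p); rewrite mem_setE in_itv. Qed.

Lemma unitI_ex x : 0 <= x <= 1 -> exists u : unitI R, \val u = x.
Proof.
move=> x01; have xI : x \in `[0%R : R, 1%R]%classic by rewrite mem_setE in_itv.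
by exists (exist _ x xI).
Qed.

Lemma act_notin f x : ~~ (0 <= x <= 1) -> act f x = x.
Proof.
move=> xn; rewrite /act; case: insubP => // u xI; exfalso.
by move: xI; rewrite mem_setE in_itv /= (negbTE xn).
Qed.

Lemma act_itv f x : (0 <= act f x <= 1) = (0 <= x <= 1).
Proof.
have [/unitI_ex[u <-]|xn] := boolP (0 <= x <= 1).
  by rewrite act_val unitI_itv.
by rewrite act_notin // (negbTE xn).
Qed.

Lemma act1 x : act 1%g x = x.
Proof.
have [/unitI_ex[u <-]|xn] := boolP (0 <= x <= 1); first by rewrite act_val.
by rewrite act_notin.
Qed.

Lemma actM f g x : act (f * g)%g x = act f (act g x).
Proof.
have [/unitI_ex[u <-]|xn] := boolP (0 <= x <= 1); first by rewrite !act_val.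
by rewrite !act_notin // act_itv.
Qed.

Lemma actK f : cancel (act f) (act f^-1%g).
Proof. by move=> x; rewrite -actM mulVg act1. Qed.

Lemma actKV f : cancel (act f^-1%g) (act f).
Proof. by move=> x; rewrite -actM mulgV act1. Qed.

Lemma act_inj f : injective (act f). Proof. exact: can_inj (actK f). Qed.

Lemma act_ext f g : act f =1 act g -> f = g.
Proof.
by move=> fg; apply: homeoI_eq => u; apply: val_inj; rewrite -!act_val.
Qed.

Lemma act_homo f : {homo act f : x y / x < y}.
Proof.
move=> x y xy.
have [/[dup] xI /unitI_ex[u xu]|xn] := boolP (0 <= x <= 1);
  have [/[dup] yI /unitI_ex[v yv]|yn] := boolP (0 <= y <= 1).
- by rewrite -xu -yv !act_val; apply: homeo_incr; rewrite xu yv.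
- have := act_itv f x; rewrite xI => fxI; rewrite (act_notin f yn).
  by move: xI yn fxI xy; lra.
- have := act_itv f y; rewrite yI => fyI; rewrite (act_notin f xn).
  by move: yI xn fyI xy; lra.
- by rewrite !act_notin.
Qed.

Lemma act_lt f x y : (act f x < act f y) = (x < y).
Proof. by apply: (leW_mono (le_mono _)); exact: act_homo. Qed.

Lemma act_le f x y : (act f x <= act f y) = (x <= y).
Proof. by apply: le_mono; exact: act_homo. Qed.

(** The preimage of 0 is at least 0, so by monotonicity 0 is sent to at most 0, hence to itself;
    dually for 1. *)
Lemma act_out f x : ~~ (0 < x < 1) -> act f x = x.
Proof.
have [xI|xn _] := boolP (0 <= x <= 1); last exact: act_notin.
have zI : 0 <= act f^-1%g 0 <= 1 by rewrite act_itv lexx ler01.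
have oI : 0 <= act f^-1%g 1 <= 1 by rewrite act_itv lexx ler01.
have xI' : 0 <= act f x <= 1 by rewrite act_itv.
have z : act f 0 <= 0 by rewrite -[leRHS](actKV f) act_le; case/andP: zI.
have o : 1 <= act f 1 by rewrite -[leLHS](actKV f) act_le; case/andP: oI.
move=> xn; have [x0|x1] : x = 0 \/ x = 1 by move: xI xn; lra.
- by rewrite x0 in z xI' *; lra.
- by rewrite x1 in o xI' *; lra.
Qed.

Lemma act0 f : act f 0 = 0. Proof. by apply: act_out; rewrite ltxx. Qed.

Lemma act_one f : act f 1 = 1. Proof. by apply: act_out; rewrite ltxx andbF. Qed.

Lemma actV_fix f x : act f x = x -> act f^-1%g x = x.
Proof. by move=> fx; rewrite -{1}fx actK. Qed.

Lemma actVlt f x y : (act f^-1%g x < y) = (x < act f y).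
Proof. by rewrite -(act_lt f) actKV. Qed.

Lemma actVle f x y : (act f^-1%g x <= y) = (x <= act f y).
Proof. by rewrite -(act_le f) actKV. Qed.

Lemma lt_actV f x y : (x < act f^-1%g y) = (act f x < y).
Proof. by rewrite -(act_lt f) actKV. Qed.

Lemma le_actV f x y : (x <= act f^-1%g y) = (act f x <= y).
Proof. by rewrite -(act_le f) actKV. Qed.

(** * Homeomorphisms from increasing bijections of the line *)

Section Build.
Variables phi psi : R -> R.
Hypotheses (phiK : cancel phi psi) (psiK : cancel psi phi).
Hypothesis phi_homo : {homo phi : x y / x < y}.
Hypothesis phi_out : forall x, ~~ (0 < x < 1) -> phi x = x.

Let phi_lt x y : (phi x < phi y) = (x < y).
Proof. by apply: (leW_mono (le_mono _)). Qed.

Let psi_lt x y : (psi x < psi y) = (x < y).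
Proof. by rewrite -phi_lt !psiK. Qed.

Let phi0 : phi 0 = 0. Proof. by apply: phi_out; rewrite ltxx. Qed.
Let phi1 : phi 1 = 1. Proof. by apply: phi_out; rewrite ltxx andbF. Qed.

Let psi_itv x : (0 <= x <= 1) -> (0 <= psi x <= 1).
Proof.
by rewrite !leNgt -(phi_lt (psi x) 0) -(phi_lt 1 (psi x)) psiK phi0 phi1.
Qed.

Let phi_itv x : (0 <= x <= 1) -> (0 <= phi x <= 1).
Proof. by rewrite !leNgt -(phi_lt x 0) -(phi_lt 1 x) phi0 phi1. Qed.

Let mono_continuous (a b : R -> R) : cancel a b -> cancel b a ->
  {homo a : x y / x < y} -> continuous a.
Proof.
move=> aK bK ah x; apply/cvgrPdist_lt => e e0.
have alt y z : (a y < a z) = (y < z) by apply: (leW_mono (le_mono _)).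
have l : b (a x - e) < x by rewrite -alt bK; lra.
have r : x < b (a x + e) by rewrite -alt bK; lra.
near=> y.
have : b (a x - e) < y by near: y; exact: lt_nbhsr.
rewrite -alt bK => ay1.
have : y < b (a x + e) by near: y; exact: lt_nbhsl.
rewrite -alt bK => ay2.
by rewrite ltr_norml; lra.
Unshelve. all: by end_near. Qed.

Let lift_fun (a : R -> R) (aI : forall x, 0 <= x <= 1 -> 0 <= a x <= 1)
  (u : unitI R) : unitI R.
Proof.
refine (exist _ (a (\val u)) _).
by apply/mem_set; rewrite /= in_itv; apply: aI; exact: unitI_itv.
Defined.

Let lift_continuous a aI : continuous a -> continuous (@lift_fun a aI).
Proof.
move=> ac; apply: continuous_comp_initial => u.
apply: (@continuous_comp _ _ _ (fun u : unitI R => \val u) a); last exact: ac.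
exact: initial_continuous.
Qed.

(** Monotonicity and bijectivity give continuity in both directions, so an increasing formula on R
    with an explicit inverse suffices to define a homeomorphism. *)
Lemma homeoI_build : exists f, act f =1 phi.
Proof.
have fK : cancel (lift_fun phi_itv) (lift_fun psi_itv).
  by move=> u; apply: val_inj => /=; rewrite phiK.
have gK : cancel (lift_fun psi_itv) (lift_fun phi_itv).
  by move=> u; apply: val_inj => /=; rewrite psiK.
have fc : continuous (lift_fun phi_itv).
  by apply: lift_continuous; apply: (mono_continuous phiK).
have gc : continuous (lift_fun psi_itv).
  apply: lift_continuous; apply: (mono_continuous psiK) => // x y.
  by rewrite psi_lt.
have fi (u v : unitI R) : (\val u < \val v)%R ->
    (\val (lift_fun phi_itv u) < \val (lift_fun phi_itv v))%R.
  exact: phi_homo.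
exists (HomeoI fK gK fc gc fi) => x.
have [/unitI_ex[u <-]|xn] := boolP (0 <= x <= 1); first by rewrite act_val.
rewrite act_notin // phi_out //.
by apply: contra xn => /andP[x0 x1]; rewrite !ltW.
Qed.

End Build.

End Action.

(** * Supports and gluing along the orbit of an interval *)
Lemma lt_int_ex (n m : int) : n < m -> exists k : nat, m = n + k.+1%:Z.
Proof. by move=> nm; exists `|m - n|%N.-1; lia. Qed.

Section IntegerPowers.
Variable G : groupType.
Implicit Types (t : G) (n : int).

Definition zpow t n : G :=
  match n with Posz k => (t ^+ k)%g | Negz k => (t ^- k.+1)%g end.

Lemma zpowD1 t n : zpow t (n + 1) = (t * zpow t n)%g.
Proof.
case: n => [k|[|k]] /=; first by rewrite addn1 expgS.
  by rewrite expg1 mulgV.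
by rewrite subn1 (expgSr t k.+1) invgM mulVKg.
Qed.

Lemma zpow_commute t n : commute t (zpow t n).
Proof. by case: n => k; [|apply: commuteV]; apply: commuteX. Qed.

End IntegerPowers.

Section GeneratedSubgroup.
Variables (G : groupType) (S : set G).

Lemma gen_subgroupP : is_subgroup (gen_subgroup S).
Proof.
split=> [K [[]]//|x y Sx Sy K KS|x Sx K KS].
- by case: (KS) => -[_ KM _] _; apply: KM; [exact: Sx|exact: Sy].
- by case: (KS) => -[_ _ KV] _; apply: KV; exact: Sx.
Qed.

Lemma gen1 : gen_subgroup S 1%g. Proof. by case: gen_subgroupP. Qed.

Lemma genM x y : gen_subgroup S x -> gen_subgroup S y ->
  gen_subgroup S (x * y)%g.
Proof. by case: gen_subgroupP => _ + _; apply. Qed.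

Lemma genV x : gen_subgroup S x -> gen_subgroup S x^-1%g.
Proof. by case: gen_subgroupP => _ _; apply. Qed.

Lemma genX x k : gen_subgroup S x -> gen_subgroup S (x ^+ k)%g.
Proof.
by move=> Sx; elim: k => [|k IH]; [exact: gen1|rewrite expgS; exact: genM].
Qed.

Lemma genJ x y : gen_subgroup S x -> gen_subgroup S y ->
  gen_subgroup S (x ^ y)%g.
Proof. by move=> Sx Sy; do 2?apply: genM => //; exact: genV. Qed.

Lemma genR x y : gen_subgroup S x -> gen_subgroup S y ->
  gen_subgroup S [~ x, y]%g.
Proof. by move=> Sx Sy; apply: genM; [exact: genV|exact: genJ]. Qed.

Lemma gen_in x : S x -> gen_subgroup S x. Proof. by move=> Sx K [_]; apply. Qed.

Lemma gen_min (K : set G) : is_subgroup K -> S `<=` K -> gen_subgroup S `<=` K.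
Proof. by move=> Kg SK x; apply. Qed.

End GeneratedSubgroup.

Section Supports.
Variable R : realType.
Implicit Types (f g : homeoI R) (l r x : R).

(** Points of (l, r) may be fixed as well, which makes the condition stable under products and
    inverses. *)
Definition supp_in l r f := forall x, ~~ (l < x < r) -> act f x = x.

Lemma supp_in1 l r : supp_in l r 1%g. Proof. by move=> x _; rewrite act1. Qed.

Lemma supp_inM l r f g : supp_in l r f -> supp_in l r g ->
  supp_in l r (f * g)%g.
Proof. by move=> sf sg x xn; rewrite actM sg // sf. Qed.

Lemma supp_inV l r f : supp_in l r f -> supp_in l r f^-1%g.
Proof. by move=> sf x xn; apply/actV_fix/sf. Qed.

Lemma supp_inJ l r f g : supp_in l r f -> supp_in l r g ->
  supp_in l r (f ^ g)%g.
Proof. by move=> sf sg; do 2?apply: supp_inM => //; exact: supp_inV. Qed.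

Lemma supp_itv l r f x : supp_in l r f -> (l < act f x < r) = (l < x < r).
Proof.
move=> sf; have [xI|xn] := boolP (l < x < r); last by rewrite sf ?(negbTE xn).
have fl : act f l = l by apply: sf; rewrite ltxx.
have fr : act f r = r by apply: sf; rewrite ltxx andbF.
by rewrite -{1}fl -{1}fr !act_lt.
Qed.

Lemma supp_in_sub l r l' r' f : l' <= l -> r <= r' ->
  supp_in l r f -> supp_in l' r' f.
Proof.
move=> ll rr sf x xn; apply: sf; apply: contra xn => /andP[lx xr].
by rewrite (le_lt_trans ll) //= (lt_le_trans xr).
Qed.

Lemma commute_split (c : R) f g : (forall x, c <= x -> act f x = x) ->
  (forall x, x <= c -> act g x = x) -> commute f g.
Proof.
move=> ff gg; apply: act_ext => x; rewrite !actM.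
have [xc|cx] := leP x c.
  by rewrite (gg x) // gg // -(ff c) // act_le.
by rewrite (ff x) ?ltW // ff // -(gg c) // act_le ltW.
Qed.

End Supports.

(** * Gluing a sequence of homeomorphisms along the translates of an interval *)

Section Gluing.
Variables (R : realType) (t : homeoI R) (l r : R).
Hypotheses (lr : l < r) (trl : act t r <= l).
Implicit Types (rho sigma : int -> homeoI R) (f : homeoI R) (n : int) (x : R).

Let piece n x := l < act (zpow t n)^-1%g x < r.

(** The translates t^n (l, r) move to the left as n grows and never overlap, because t sends r to at
    most l. *)
Let zpow_shift n k : act (zpow t (n + k.+1%:Z)) r <= act (zpow t n) l.
Proof.
elim: k => [|k IH].
  by rewrite zpowD1 zpow_commute actM act_le.
apply: le_trans IH.
rewrite -[k.+2]addn1 PoszD addrA zpowD1 zpow_commute actM act_le.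
exact: le_trans trl (ltW lr).
Qed.

Let piece_lt n m x : n < m -> piece n x -> piece m x -> False.
Proof.
move=> /lt_int_ex[k ->].
rewrite /piece => /andP[+ _] /andP[_ +].
rewrite lt_actV actVlt => h1 h2.
by have := lt_trans h1 (lt_le_trans h2 (zpow_shift n k)); rewrite ltxx.
Qed.

Let piece_uniq n m x : piece n x -> piece m x -> n = m.
Proof.
move=> px py; case: (ltgtP n m) => // nm.
- by case: (piece_lt nm px py).
- by case: (piece_lt nm py px).
Qed.

(* [glued rho f]: [f] acts on each interval t^n (l, r) as the conjugate of
   [rho n] by t^n, and trivially elsewhere. *)
Definition glued rho f :=
  (forall n x, l < act (zpow t n)^-1%g x < r ->
     act f x = act (zpow t n) (act (rho n) (act (zpow t n)^-1%g x))) /\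
  (forall x, (forall n, ~~ (l < act (zpow t n)^-1%g x < r)) -> act f x = x).

Lemma glued_uniq rho f g : glued rho f -> glued rho g -> f = g.
Proof.
move=> [f1 f2] [g1 g2]; apply: act_ext => x.
have [[n xn]|/forallNP xn] := pselect (exists n, piece n x).
  by rewrite (f1 n) // (g1 n).
have xn' n : ~~ (l < act (zpow t n)^-1%g x < r) by apply/negP/xn.
by rewrite f2 // g2.
Qed.

Definition admissible rho := forall n, supp_in l r (rho n).

Let gfun rho x : R :=
  if pselect (exists n, piece n x) is left e then
    let n := projT1 (cid e) in
    act (zpow t n) (act (rho n) (act (zpow t n)^-1%g x))
  else x.

Let gfun_in rho n x : piece n x ->
  gfun rho x = act (zpow t n) (act (rho n) (act (zpow t n)^-1%g x)).
Proof.
move=> xn; rewrite /gfun; case: pselect => [e|[]]; last by exists n.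
by rewrite (piece_uniq (projT2 (cid e)) xn).
Qed.

Let gfun_out rho x : (forall n, ~~ piece n x) -> gfun rho x = x.
Proof.
move=> xn; rewrite /gfun; case: pselect => // e.
by case: (e) => n pn; case/negP: (xn n).
Qed.

Let gfun_piece rho n x : admissible rho -> piece n (gfun rho x) = piece n x.
Proof.
move=> ad; have [[m xm]|/forallNP xn] := pselect (exists m, piece m x).
  have pm : piece m (gfun rho x).
    by rewrite (gfun_in _ xm) /piece actK supp_itv.
  have [->|nm] := eqVneq n m; first by rewrite pm xm.
  have np z : piece m z -> piece n z = false.
    by move=> pz; apply/negP => /piece_uniq/(_ pz) nmE; rewrite nmE eqxx in nm.
  by rewrite !np.
by rewrite gfun_out // => m; apply/negP.
Qed.

Let gfunK rho sigma : admissible rho ->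
  (forall n, (sigma n * rho n)%g = 1%g) -> cancel (gfun rho) (gfun sigma).
Proof.
move=> ad sr x; have [[n xn]|/forallNP xn] := pselect (exists n, piece n x).
  rewrite (gfun_in (n := n) sigma); last by rewrite gfun_piece.
  by rewrite (gfun_in _ xn) actK -[act (sigma n) _]actM sr act1 actKV.
by rewrite !gfun_out // => m; apply/negP.
Qed.

(** Used to compare points of different translates: a point to the right of t^n (l, r) is fixed or
    lies in a translate of smaller index, which [gfun] preserves. *)
Let gfun_ge rho n y : admissible rho ->
  act (zpow t n) r <= y -> act (zpow t n) r <= gfun rho y.
Proof.
move=> ad ry; have [[m ym]|/forallNP yn] := pselect (exists n, piece n y); last first.
  by rewrite gfun_out // => m; apply/negP.
have := ym; rewrite -(gfun_piece m y ad) => /andP[+ _]; rewrite lt_actV => gy.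
have /andP[_] := ym; rewrite actVlt => yr.
have [mn|nm|mn] := ltgtP m n.
- have [k nE] := lt_int_ex mn; apply: le_trans (ltW gy).
  by rewrite nE; exact: zpow_shift.
- have [k mE] := lt_int_ex nm.
  have := zpow_shift n k; rewrite -mE => /(lt_le_trans (le_lt_trans ry yr)).
  by rewrite act_lt => /lt_trans/(_ lr); rewrite ltxx.
- by have := le_lt_trans ry yr; rewrite mn ltxx.
Qed.

Let gfun_homo rho : admissible rho -> {homo gfun rho : x y / x < y}.
Proof.
move=> ad x y xy.
have [[n xn]|/forallNP xn] := pselect (exists n, piece n x); last first.
  have -> : gfun rho x = x by apply: gfun_out => m; apply/negP.
  have [[m ym]|/forallNP yn] := pselect (exists n, piece n y); last first.
    by rewrite gfun_out // => m; apply/negP.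
  have := ym; rewrite -(gfun_piece m y ad) => /andP[+ _]; rewrite lt_actV.
  apply: le_lt_trans; have /negP := xn m; rewrite /piece negb_and -!leNgt.
  rewrite actVle le_actV => /orP[//|rx]; case/andP: ym => _; rewrite actVlt => yr.
  by have := lt_trans (le_lt_trans rx xy) yr; rewrite ltxx.
have [yn|yn] := boolP (piece n y).
  by rewrite (gfun_in _ xn) (gfun_in _ yn) !act_lt.
have := xn; rewrite -(gfun_piece n x ad) => /andP[_]; rewrite actVlt.
move=> /lt_le_trans; apply; apply: gfun_ge => //.
move: yn; rewrite /piece negb_and -!leNgt actVle le_actV => /orP[yl|//].
case/andP: xn; rewrite lt_actV => lx _.
by have := lt_trans lx (lt_le_trans xy yl); rewrite ltxx.
Qed.

Lemma glued_ex rho : admissible rho -> exists f, glued rho f.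
Proof.
move=> ad; have adV : admissible (fun n => (rho n)^-1%g).
  by move=> n; exact: supp_inV.
have [||||f fE] := @homeoI_build R (gfun rho) (gfun (fun n => (rho n)^-1%g)).
- by apply: gfunK => // n; rewrite mulVg.
- by apply: gfunK => // n; rewrite mulgV.
- exact: gfun_homo.
- move=> x xn; have [[n px]|/forallNP px] := pselect (exists n, piece n x).
    by rewrite (gfun_in _ px) !(act_out _ xn).
  by rewrite gfun_out // => n; apply/negP.
exists f; split=> [n x xn|x xn]; rewrite fE; first exact: gfun_in.
exact: gfun_out.
Qed.

(** The value 1 is a default for sequences without a glued map; admissible sequences always have
    one. *)
Definition shift_glue rho : homeoI R := xget 1%g [set f | glued rho f].

Lemma shift_glueP rho : admissible rho -> glued rho (shift_glue rho).
Proof. by move=> /glued_ex[f fP]; exact: (xgetI 1%g fP). Qed.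

Lemma glue_eq rho f : glued rho f -> shift_glue rho = f.
Proof. by move=> fP; apply: (glued_uniq _ fP); exact: (xgetI 1%g fP). Qed.

Lemma shift_glueM rho sigma : admissible rho -> admissible sigma ->
  shift_glue (fun n => rho n * sigma n)%g = (shift_glue rho * shift_glue sigma)%g.
Proof.
move=> /[dup] adr /shift_glueP[r1 r2] /[dup] ads /shift_glueP[s1 s2].
apply: glue_eq; split=> [n x xn|x xn]; rewrite !actM; last by rewrite s2 // r2.
rewrite (s1 n) // (r1 n); first by rewrite actK.
by rewrite actK supp_itv.
Qed.

Lemma shift_glue1 : shift_glue (fun=> 1%g) = 1%g.
Proof. by apply: glue_eq; split=> [n x _|x _]; rewrite !act1 ?actKV. Qed.

Lemma shift_glueV rho : admissible rho ->
  shift_glue (fun n => (rho n)^-1)%g = (shift_glue rho)^-1%g.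
Proof.
move=> ad; apply/esym/mulg1_eq.
rewrite -shift_glueM => [|//|n]; last exact: supp_inV.
by rewrite -shift_glue1; congr shift_glue; apply/funext => n; rewrite mulgV.
Qed.

(** [t] carries the translate of index n - 1 onto that of index n, so conjugation by [t] reindexes
    the sequence without changing its terms. *)
Lemma glue_shift rho : admissible rho ->
  (t * shift_glue rho * t^-1)%g = shift_glue (fun n => rho (n - 1)).
Proof.
move=> /shift_glueP[r1 r2]; apply/esym/glue_eq.
have sh n x : act (zpow t (n - 1))^-1%g (act t^-1%g x) = act (zpow t n)^-1%g x.
  by rewrite -actM -invgM -zpowD1 subrK.
split=> [n x xn|x xn]; rewrite !actM.
  rewrite (r1 (n - 1)); last by rewrite sh.
  by rewrite sh -[act t _]actM -zpowD1 subrK.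
by rewrite r2 ?actKV // => n; rewrite -[n](addrK 1) sh.
Qed.

Lemma glue_inj rho sigma : admissible rho -> admissible sigma ->
  shift_glue rho = shift_glue sigma -> rho =1 sigma.
Proof.
move=> /[dup] adr /shift_glueP[r1 _] /[dup] ads /shift_glueP[s1 _] e n.
apply: act_ext => x.
have [xn|xn] := boolP (l < x < r); last by rewrite adr // ads.
apply: (@act_inj _ (zpow t n)).
have := s1 n (act (zpow t n) x); rewrite -e actK => <- //.
by rewrite (r1 n) actK.
Qed.

(** Rewrites an element supported in the base interval as a glued one, so that it can be multiplied
    with other glued elements term by term. *)
Lemma glue_delta f : supp_in l r f ->
  shift_glue (fun n => if n == 0 then f else 1%g) = f.
Proof.
move=> sf; apply: glue_eq; split=> [n x xn|x xn].
  case: eqVneq xn => [->|n0 xn]; first by rewrite /= invg1 !act1.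
  rewrite act1 actKV sf //; apply/negP => x0; move: n0.
  by rewrite (@piece_uniq n 0 x) // /piece /= invg1 act1.
by rewrite sf //; have := xn 0; rewrite /= invg1 act1.
Qed.

(** A fixed point of [t] outside (l, r) lies in no translate; this bounds the support of a glued
    element by that of [t]. *)
Lemma glue_fix rho x : admissible rho -> act t x = x -> ~~ (l < x < r) ->
  act (shift_glue rho) x = x.
Proof.
move=> /shift_glueP[_ g2] tx xn; apply: g2 => n.
suff -> : act (zpow t n)^-1%g x = x by [].
apply: actV_fix.
have tX k : act (t ^+ k)%g x = x.
  by elim: k => [|k IH]; rewrite ?act1 // expgS actM IH.
by case: n => k /=; [|apply: actV_fix]; exact: tX.
Qed.

End Gluing.

(** * Presented groups and normal forms in F *)
Section Multiplicative.
Variables (G K : groupType) (phi : {multiplicative G -> K}).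

Lemma mult1 : phi 1%g = 1%g.
Proof. by apply: (mulgI (phi 1%g)); rewrite -gmulfM !mulg1. Qed.

Lemma multV x : phi x^-1%g = (phi x)^-1%g.
Proof. by apply: (mulgI (phi x)); rewrite -gmulfM !mulgV mult1. Qed.

Lemma multX x k : phi (x ^+ k)%g = (phi x ^+ k)%g.
Proof. by elim: k => [|k IH]; rewrite ?mult1 // !expgS gmulfM IH. Qed.

Lemma multJ x y : phi (x ^ y)%g = (phi x ^ phi y)%g.
Proof. by rewrite /conjg !gmulfM multV. Qed.

Lemma mult_inj : (forall x, phi x = 1%g -> x = 1%g) -> injective phi.
Proof.
by move=> phi1 x y xy; apply/divg1_eq/phi1; rewrite gmulfM multV xy mulgV.
Qed.

End Multiplicative.

Section PresentedGroupTheory.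
Variables (T : Type) (rels : set (gterm T)).

Lemma pres_piM x y :
  pres_pi rels (x * y)%g = (pres_pi rels x * pres_pi rels y)%g.
Proof. by rewrite -pres_pi_mul. Qed.

Lemma pres_piV x : pres_pi rels x^-1%g = (pres_pi rels x)^-1%g.
Proof. by rewrite -pres_pi_inv. Qed.

Lemma pres_ind (K : set (presented rels)) : is_subgroup K ->
  (forall s, K (pres_pi rels (GGen s))) -> forall u, K u.
Proof.
move=> [K1 KM KV] KT u; rewrite -(pres_reprK u).
elim: (pres_repr u) => [s||x Kx y Ky|x Kx]; first exact: KT.
- exact: K1.
- by rewrite [X in K X]pres_piM; exact: KM.
- by rewrite [X in K X]pres_piV; exact: KV.
Qed.

Variables (G : groupType) (v : T -> G).

Fixpoint geval (x : gterm T) : G :=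
  match x with
  | GGen s => v s
  | GOne => 1%g
  | GMul x y => (geval x * geval y)%g
  | GInv x => (geval x)^-1%g
  end.

Hypothesis geval_rel : forall x, rels x -> geval x = 1%g.

Lemma geval_pres x y : pres_eq rels x y -> geval x = geval y.
Proof.
elim=> {x y} //=.
- by move=> y x z _ -> _ ->.
- by move=> x x' y y' _ -> _ ->.
- by move=> x x' _ ->.
- by move=> x y z; rewrite mulgA.
- by move=> x; rewrite mul1g.
- by move=> x; rewrite mulg1.
- by move=> x; rewrite mulVg.
- by move=> x; rewrite mulgV.
Qed.

Lemma geval_repr x : geval (pres_repr (pres_pi rels x)) = geval x.
Proof. by apply/geval_pres/pres_piP; rewrite pres_reprK. Qed.

Lemma pres_lift : exists phi : {multiplicative presented rels -> G},
  forall s, phi (pres_pi rels (GGen s)) = v s.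
Proof.
pose f (u : presented rels) := geval (pres_repr u).
have fM : {morph f : x y / (x * y)%g}.
  by move=> x y; exact: (geval_repr (pres_repr x * pres_repr y)%g).
pose phi : {multiplicative presented rels -> G} :=
  HB.pack f (isMultiplicative.Build _ _ f fM).
by exists phi => s; exact: geval_repr.
Qed.

End PresentedGroupTheory.

(** * Infinite presentation, positive words and fractions in F *)

Section NormalForms.
Variables (G : groupType) (a b : G).

(* The generators x_0 = a, x_(n+1) = b ^ (a ^+ n) of the infinite presentation
   of F, in which x_i conjugates x_j to x_(j+1) for i < j. *)
Definition Fgen n : G := if n is k.+1 then (b ^ (a ^+ k))%g else a.

Hypothesis rel1 : commute (a * b^-1)%g (b ^ a)%g.
Hypothesis rel2 : commute (a * b^-1)%g (b ^ (a ^+ 2))%g.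
Local Notation X := Fgen.

Let Xadd j k : X (j.+1 + k) = (X j.+1 ^ (a ^+ k))%g.
Proof. by rewrite addSn /= -conjgM -expgnDr. Qed.

Local Arguments Fgen : simpl never.

Let XS j : X j.+2 = (X j.+1 ^ a)%g.
Proof. by rewrite -addn1 Xadd expg1. Qed.

(** An element commuting with a b^-1 has the same conjugates by a and by b. *)
Let conj_ab j : commute (a * b^-1)%g (X j.+1) -> (X j.+1 ^ b)%g = X j.+2.
Proof.
move=> cX; rewrite XS -{1}(mulgVK b a) conjgM; congr (_ ^ b)%g.
by apply/esym/conjg_fixP/commgP; exact: commute_sym.
Qed.

(** The two relators start a strong induction: x_(j+4) is the conjugate of x_(j+3) by x_2 = b ^ a,
    and both of these commute with a b^-1. *)
Let commX j : commute (a * b^-1)%g (X j.+2).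
Proof.
elim: j {-2}j (leqnn j) => [|m IH] [|[|j]] jm;
  [exact: rel1|by []|by []|exact: rel1|exact: rel2|].
have cj : commute (a * b^-1)%g (X j.+2) by apply: IH; lia.
have cj' : commute (a * b^-1)%g (X j.+3) by apply: IH; lia.
have -> : X j.+4 = (X j.+3 ^ (b ^ a))%g.
  by rewrite [LHS]XS -[in LHS](conj_ab cj) conjJg -[in LHS](XS j.+1).
apply: commuteM; first exact: commuteV.
by apply: commuteM.
Qed.

(** For i = 0 this is the definition of x_j; for i > 0, conjugation by a power of a reduces it to
    x_1 = b, where [conj_ab] applies. *)
Lemma Fgen_conj i j : (i < j)%N -> (X j ^ X i)%g = X j.+1.
Proof.
case: j => // j; case: i => [_|i]; first by rewrite XS.
rewrite ltnS => ij; pose k := (j - i.+1)%N.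
have e1 : j.+1 = (k.+2 + i)%N by rewrite /k; lia.
have e2 : j.+2 = (k.+3 + i)%N by rewrite /k; lia.
by rewrite e2 e1 !Xadd -(conj_ab (commX k)) -conjJg.
Qed.

Lemma Fgen_swap i j e : (i < j)%N -> (X j * X i ^+ e = X i ^+ e * X (j + e))%g.
Proof.
move=> ij; elim: e => [|e IH]; first by rewrite addn0 mulg1 mul1g.
rewrite expgSr mulgA IH -!mulgA; congr (_ * _)%g.
by rewrite conjgC Fgen_conj ?addnS // ltn_addr.
Qed.

Fixpoint Fword (w : seq nat) : G :=
  if w is i :: w' then (X i * Fword w')%g else 1%g.

Lemma Fword_cat w w' : Fword (w ++ w') = (Fword w * Fword w')%g.
Proof. by elim: w => [|i w IH] /=; rewrite ?mul1g // IH mulgA. Qed.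

(** Positive words sorted by index: [l] lists the exponents of x_n, x_(n+1), and so on. Trailing
    zeros are allowed, so [l] is not unique. *)
Fixpoint Fnf n (l : seq nat) : G :=
  if l is e :: l' then (X n ^+ e * Fnf n.+1 l')%g else 1%g.

Lemma Fnf_split n l : Fnf n l = (X n ^+ head 0%N l * Fnf n.+1 (behead l))%g.
Proof. by case: l => //=; rewrite mulg1. Qed.

Lemma Fnf_push n i l : exists l', (X (n + i) * Fnf n l)%g = Fnf n l'.
Proof.
elim: l n i => [|e l IH] n i.
  elim: i n => [|i IH] n; first by exists [:: 1%N]; rewrite addn0.
  have [l' ll'] := IH n.+1; exists (0%N :: l').
  by rewrite [RHS]/= mul1g -ll' addSnnS.
case: i => [|i]; first by exists (e.+1 :: l); rewrite addn0 /= expgS mulgA.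
have [l' ll'] := IH n.+1 (i + e)%N; exists (e :: l').
rewrite [Fnf n (_ :: l)]/= mulgA Fgen_swap -?mulgA; last first.
  by rewrite addnS ltnS leq_addr.
by rewrite (_ : (n + i.+1 + e = n.+1 + (i + e))%N) ?ll' //; lia.
Qed.

Lemma Fword_nf w : exists l, Fword w = Fnf 0 l.
Proof.
elim: w => [|i w [l IH]]; first by exists [::].
by have [l' ll'] := Fnf_push 0 i l; exists l'; rewrite -ll' /= IH.
Qed.

(** The inverse of x_i travels to the right: passing x_j raises the larger of the two indices by
    one, and meeting x_i itself cancels it. At most one inverse is left, at the end. *)
Lemma Fword_divl w i : exists w1 w2,
  ((X i)^-1 * Fword w = Fword w1 * (Fword w2)^-1)%g.
Proof.
elim: w i => [|j w IH] i.
  by exists [::], [:: i]; rewrite /= !mulg1 mul1g.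
have [ij|ji|->] := ltngtP i j.
- have [w1 [w2 e]] := IH i; exists (j.+1 :: w1), w2.
  rewrite /= -[RHS]mulgA -e !mulgA; congr (_ * _)%g.
  by rewrite -(Fgen_conj ij) /conjg !mulgA mulgK.
- have [w1 [w2 e]] := IH i.+1; exists (j :: w1), w2.
  rewrite /= -[RHS]mulgA -e !mulgA; congr (_ * _)%g.
  by rewrite -(Fgen_conj ji) /conjg !invgM invgK !mulgA mulgV mul1g.
- by exists w, [::]; rewrite /= mulKg invg1 mulg1.
Qed.

(** Left multiplication by a generator or its inverse preserves fractions of positive words. The
    elements [K] that do so together with their inverses form a subgroup; applying one to 1 gives
    the fraction. *)
Lemma Ffraction x : gen_subgroup [set a; b] x ->
  exists l l', x = (Fnf 0 l * (Fnf 0 l')^-1)%g.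
Proof.
pose frac (x : G) := exists w w', x = (Fword w * (Fword w')^-1)%g.
pose K : set G := [set x | (forall h, frac h -> frac (x * h)%g) /\
  (forall h, frac h -> frac (x^-1 * h)%g)].
have KX i : K (X i).
  split=> _ [w [w' ->]]; first by exists (i :: w), w'; rewrite /= mulgA.
  have [w1 [w2 e]] := Fword_divl w i; exists w1, (w' ++ w2).
  by rewrite mulgA e Fword_cat invgM mulgA.
have Kg : is_subgroup K.
  split=> [|y z [y1 y2] [z1 z2]|y [y1 y2]]; split=> h hf.
  - by rewrite mul1g.
  - by rewrite invg1 mul1g.
  - by rewrite -mulgA; apply/y1/z1.
  - by rewrite invgM -mulgA; apply/z2/y2.
  - exact: y2.
  - by rewrite invgK; exact: y1.
move=> /(gen_min Kg); case=> [_ [->|->]|+ _].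
- exact: (KX 0%N).
- by have := KX 1%N; rewrite /Fgen expg0 conjg1.
case/(_ 1%g) => [|w [w']]; first by exists [::], [::]; rewrite mulgV.
rewrite mulg1 => ->.
have [l ->] := Fword_nf w; have [l' ->] := Fword_nf w'; by exists l, l'.
Qed.

End NormalForms.

(** * Fast two-chains generate F *)
Lemma thompsonF_ind (K : set thompsonF) :
  is_subgroup K -> K F_a -> K F_b -> forall u, K u.
Proof. by move=> Kg Ka Kb; apply: pres_ind => // -[]. Qed.

Lemma thompsonF_lift (G : groupType) (x y : G) :
  commute (x * y^-1)%g (y ^ x)%g -> commute (x * y^-1)%g (y ^ (x ^+ 2))%g ->
  exists phi : {multiplicative thompsonF -> G}, phi F_a = x /\ phi F_b = y.
Proof.
move=> xy1 xy2; pose v (s : F_generator) := if s is Fgen_a then x else y.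
have [|phi phiE] := @pres_lift F_generator F_relators _ v.
  by move=> _ [->|->] /=; apply/eqP/commgP.
by exists phi; split; rewrite /F_a /F_b phiE.
Qed.

Section FastChain.
Variables (R : realType) (A B : homeoI R) (alpha beta : R).
Hypotheses (alpha0 : 0 < alpha) (alpha_beta : alpha < beta) (beta1 : beta < 1).
Hypothesis A_fix : forall x, beta <= x -> act A x = x.
Hypothesis A_move : forall x, 0 < x -> x < beta -> act A x < x.
Hypothesis B_fix : forall x, x <= alpha -> act B x = x.
Hypothesis B_move : forall x, alpha < x -> x < 1 -> act B x < x.
Hypothesis AB_fast : act A (act B beta) <= alpha.
Implicit Types (x : R) (n : nat).

(** With a = A B and b = B, the element a b^-1 of the relators becomes [A]. *)
Local Notation a := (A * B)%g.

Let B_le x : act B x <= x.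
Proof.
have [/B_fix->//|xa] := leP x alpha.
have [x1|x1] := ltP x 1; first exact/ltW/B_move.
by rewrite act_out // negb_and -!leNgt x1 orbT.
Qed.

Let a_move x : 0 < x -> x < 1 -> act a x < x.
Proof.
move=> x0 x1; rewrite actM; have [xa|xa] := leP x alpha.
  by rewrite B_fix // A_move // (le_lt_trans xa).
apply: (@le_lt_trans _ _ (act B x)); last exact: B_move.
have [yb|yb] := ltP (act B x) beta; last by rewrite A_fix.
by rewrite ltW // A_move // -(act0 B) act_lt.
Qed.

(* The image of x_n is supported on (c n, 1). *)
Let c n : R := if n is k.+1 then act (a ^- k)%g alpha else 0.

Let c_itv n : 0 <= c n < 1.
Proof.
case: n => [|k] /=; first by rewrite lexx ltr01.
by rewrite -[leLHS](act0 (a ^- k)%g) -[ltRHS](act_one (a ^- k)%g) act_le act_lt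
  ltW //= (lt_trans alpha_beta).
Qed.

Let c_lt n : c n < c n.+1.
Proof.
case: n => [|k]; first by rewrite /= expg0 invg1 act1.
rewrite [c k.+2]/= expgS invgM actM -/(c k.+1) act_lt lt_actV.
by rewrite a_move // (lt_trans alpha_beta).
Qed.

Let Y := Fgen a B.

Let Y_fix n x : x <= c n -> act (Y n) x = x.
Proof.
case: n => [|k] /= xc; first by rewrite act_out // negb_and -!leNgt xc.
by rewrite /conjg !actM B_fix ?actK // -le_actV.
Qed.

Let Y_move n x : c n < x -> x < 1 -> act (Y n) x < x.
Proof.
case: n => [|k] /= xc x1; first exact: a_move.
rewrite /conjg !actM actVlt; apply: B_move; first by rewrite -actVlt.
by rewrite -(act_one (a ^+ k)%g) act_lt.
Qed.

Let Y_expg_lt n x i j : c n < x -> x < 1 -> (i < j)%N ->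
  act (Y n ^+ j)%g x < act (Y n ^+ i)%g x.
Proof.
move=> xc x1 /subnK <-; elim: (j - i.+1)%N => [|k IH].
  by rewrite add0n expgSr actM act_lt Y_move.
by apply: lt_trans IH; rewrite addSn expgSr actM act_lt Y_move.
Qed.

(** The supports are disjoint: the conjugate of [B] is supported to the right of c (n + 2), and beta
    <= c 2 is a restatement of [AB_fast]. *)
Lemma A_commute n : commute A (B ^ (a ^+ n.+1))%g.
Proof.
apply: (@commute_split _ beta) => // x xb; apply: (Y_fix (n := n.+2)).
apply: le_trans xb _; elim: n => [|n IH]; last exact/ltW/(le_lt_trans IH)/c_lt.
by rewrite /= expg1 le_actV actM.
Qed.

Let chain_action : exists pi : {multiplicative thompsonF -> homeoI R},
  pi F_a = a /\ pi F_b = B.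
Proof.
apply: thompsonF_lift; rewrite mulgK; first exact: (A_commute 0).
exact: (A_commute 1).
Qed.

Let F_rel n : (n < 2)%N -> commute (F_a * F_b^-1)%g (F_b ^ (F_a ^+ n.+1))%g.
Proof.
move=> n2; apply/commgP/eqP.
have relE r : F_relators r -> pres_pi F_relators r = 1%g.
  by move/pres_rel/pres_piP.
have piE (x y z : gterm F_generator) :
    let p := pres_pi F_relators in
    (p [~ x * y^-1, y ^ z] = [~ p x * (p y)^-1, p y ^ p z])%g.
  by rewrite /= /commg /conjg !pres_piM !pres_piV !pres_piM !pres_piV.
case: n n2 => [|[|//]] _.
  by rewrite -piE; apply: relE; left.
rewrite -(relE _ (or_intror erefl)).
by rewrite [RHS](piE _ _ (GGen Fgen_a * GGen Fgen_a)%g) pres_piM.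
Qed.

Let F_gen u : gen_subgroup [set F_a; F_b] u.
Proof.
move: u; apply: thompsonF_ind; first exact: gen_subgroupP.
  by apply: gen_in; left.
by apply: gen_in; right.
Qed.

(** At the point c (n + 1) the generators from x_(n+1) on act trivially, so the image of this point
    under a normal form determines the exponent of x_n. After cancelling that power the remaining
    exponents follow in the same way. By [Ffraction], a kernel element amounts to two normal forms
    with the same image. *)
Lemma fast_chain_F : isomorphic_to_subgroup thompsonF (gen_subgroup [set A; B]).
Proof.
have [pi [pia pib]] := chain_action; exists pi.
have piX n : pi (Fgen F_a F_b n) = Y n.
  case: n => [|k]; first exact: pia.
  by rewrite /Y /Fgen multJ multX pia pib.
have pi_nf n l x : x <= c n -> act (pi (Fnf F_a F_b n l)) x = x.
  elim: l n => [|e l IH] n xc /=; first by rewrite mult1 act1.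
  rewrite gmulfM multX piX actM IH; last exact/ltW/(le_lt_trans xc)/c_lt.
  by elim: e => [|e IHe]; rewrite ?act1 // expgS actM IHe Y_fix.
(* The bound k serves both lists, as their lengths may differ; an absent exponent is read as 0. *)
have nf_inj k l l' n : (size l <= k)%N -> (size l' <= k)%N ->
    pi (Fnf F_a F_b n l) = pi (Fnf F_a F_b n l') ->
    Fnf F_a F_b n l = Fnf F_a F_b n l'.
  elim: k l l' n => [|k IH] l l' n.
    by rewrite !leqn0 !size_eq0 => /eqP-> /eqP->.
  move=> lk l'k; rewrite !(Fnf_split _ _ n) => e.
  have cn1 : c n.+1 < 1 by case/andP: (c_itv n.+1).
  have eh : head 0%N l = head 0%N l'.
    have := congr1 (fun h => act h (c n.+1)) e.
    rewrite !gmulfM !multX !actM !pi_nf // !piX.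
    case: (ltngtP (head 0%N l) (head 0%N l')) => // h.
      by have := Y_expg_lt (c_lt n) cn1 h => /[swap] ->; rewrite ltxx.
    by have := Y_expg_lt (c_lt n) cn1 h => /[swap] ->; rewrite ltxx.
  rewrite eh; congr (_ * _)%g; apply: IH; rewrite ?size_behead.
  - by case: (size l) lk.
  - by case: (size l') l'k.
  - by move: e; rewrite eh !gmulfM => /mulgI.
split.
- apply: mult_inj => u.
  have [l [l' ->]] := Ffraction (@F_rel 0 isT) (@F_rel 1 isT) (F_gen u).
  rewrite gmulfM multV => /divg1_eq/(@nf_inj (maxn (size l) (size l'))).
  by move=> ->; rewrite ?mulgV ?leq_maxl ?leq_maxr.
- have piA : pi (F_a * F_b^-1)%g = A by rewrite gmulfM multV pia pib mulgK.
  have rg : is_subgroup (range pi).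
    split=> [|_ _ [x _ <-] [y _ <-]|_ [x _ <-]].
    - by exists 1%g => //; rewrite mult1.
    - by exists (x * y)%g => //; rewrite gmulfM.
    - by exists x^-1%g => //; rewrite multV.
  apply/seteqP; split=> [_ [u _ <-]|]; last first.
    by apply: gen_min => // _ [->|->]; [exists (F_a * F_b^-1)%g|exists F_b].
  move: u; apply: thompsonF_ind; rewrite /= ?pia ?pib.
  - split=> [|x y Sx Sy|x Sx] /=.
    - by rewrite mult1; exact: gen1.
    - by rewrite gmulfM; exact: genM.
    - by rewrite multV; exact: genV.
  - by apply: genM; apply: gen_in; [left|right].
  - by apply: gen_in; right.
Qed.

Let B_iter_ge k x : alpha <= x -> alpha <= act (B ^+ k)%g x.
Proof.
move=> ax; elim: k => [|k IH]; first by rewrite act1.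
by rewrite expgS actM -[leLHS](B_fix (lexx alpha)) act_le.
Qed.

(* The iterates of [x] decrease to a fixed point of [B], hence to [alpha]. *)
Lemma B_contract x e : alpha < x -> x < 1 -> alpha < e ->
  exists k, act (B ^+ k)%g x < e.
Proof.
move=> ax x1 ae; apply: contrapT => /forallNP ne.
have {}ne k : e <= act (B ^+ k)%g x by rewrite leNgt; exact/negP.
pose E := range (fun k => act (B ^+ k)%g x).
have Elb : lbound E e by move=> _ [k _ <-].
have Ehi : has_inf E by split; [exists x, 0%N; rewrite //= act1|exists e].
have em : e <= inf E by apply: lb_le_inf => //; case: Ehi.
have mE k : inf E <= act (B ^+ k)%g x.
  by apply: ge_inf; [exists e|exists k].
have Bm : act B (inf E) < inf E.
  apply: B_move; first exact: lt_le_trans em.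
  by apply: le_lt_trans x1; have := mE 0%N; rewrite act1.
have [_ [k _ <-] km] : exists2 y, E y & y < act B^-1%g (inf E).
  by apply: inf_lt; [case: Ehi|rewrite lt_actV].
by move: km; rewrite lt_actV -actM -expgS ltNge mE.
Qed.

Lemma supp_in_conj l r (f h : homeoI R) : supp_in l r f ->
  supp_in (act h^-1%g l) (act h^-1%g r) (f ^ h)%g.
Proof.
move=> sf x xn; rewrite /conjg !actM sf ?actK //.
by move: xn; rewrite actVlt lt_actV.
Qed.

(** The commutator of [A] and [B] is supported in (alpha, B^-1 beta). Conjugation by [a] brings this
    interval to the right of A^-1 alpha. Then powers of B ^ A, which contracts (A^-1 alpha, 1)
    towards its left end, squeeze it below e. *)
Lemma chain_small_element e : act A^-1%g alpha < e -> exists t,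
  [/\ gen_subgroup [set A; B] t, supp_in (act A^-1%g alpha) e t & t <> 1%g].
Proof.
set d := act A^-1%g alpha => de.
have [AG BG] : gen_subgroup [set A; B] A /\ gen_subgroup [set A; B] B.
  by split; apply: gen_in; [left|right].
have BV_ge x : x <= act B^-1%g x by rewrite le_actV B_le.
pose r := act B^-1%g beta.
have br : beta <= r by [].
have sAB : supp_in alpha r [~ A, B]%g.
  move=> x; rewrite negb_and -!leNgt /commg /conjg !actM => /orP[xa|rx].
    have Axa : act A x <= alpha.
      have [x0|x0] := ltP 0 x; last by rewrite act_out // negb_and -!leNgt x0.
      by rewrite (le_trans _ xa) // ltW // A_move // (le_lt_trans xa).
    by rewrite (B_fix xa) (actV_fix (B_fix Axa)) actK.
  rewrite (A_fix (x := act B x)) ?actK; last by rewrite -actVle.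
  exact/actV_fix/A_fix/(le_trans br).
(* If they commuted, A B beta = B A beta = B beta would be at most alpha = B alpha, although alpha <
   beta. *)
have ABn1 : [~ A, B]%g <> 1%g.
  move/eqP/commgP => AB; have := AB_fast; rewrite -actM AB actM A_fix //.
  by rewrite -[leRHS](B_fix (lexx alpha)) act_le leNgt alpha_beta.
have ar : act a^-1%g r < 1.
  by rewrite -(act_one a^-1%g) act_lt -(act_one B^-1%g) act_lt.
have da : d <= act a^-1%g alpha by rewrite invgM actM.
have dr : d < act a^-1%g r.
  by apply: (le_lt_trans da); rewrite act_lt (lt_le_trans alpha_beta).
pose B' := (B ^ A)%g.
have B'E k : (B' ^+ k = (B ^+ k) ^ A)%g by rewrite conjXg.
(* The wanted inequality (B ^ A)^k (a^-1 r) < e, transported by [A] so that [B_contract] applies. *)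
have [k kr] : exists k, act (B ^+ k)%g (act A (act a^-1%g r)) < act A e.
  apply: B_contract; [by rewrite -actVlt| |by rewrite -actVlt].
  by rewrite -[ltRHS](act_one A) act_lt.
exists ([~ A, B] ^ (a * (B' ^- k)))%g; split.
- apply: genJ; first exact: genR AG BG.
  exact: genM (genM AG BG) (genV (genX k (genJ BG AG))).
- apply: supp_in_sub (supp_in_conj sAB).
    rewrite invgM invgK actM B'E /conjg !actM le_actV [act A d]actKV.
    by apply: B_iter_ge; rewrite -actVle.
  by rewrite invgM invgK actM B'E /conjg !actM ltW // actVlt.
- by move/eqP; rewrite conjg_eq1 => /eqP.
Qed.

End FastChain.

(** * The initial pair *)
Section PiecewiseLinear.
Variable R : realType.
Implicit Types (l p q r x y : R).

(** The affine map fixing l and sending p to q. *)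
Let line l p q x := l + (x - l) * ((q - l) / (p - l)).

Let lineK l p q : p != l -> q != l -> cancel (line l p q) (line l q p).
Proof.
move=> pl ql x; rewrite /line addrAC subrr add0r -mulrA.
by rewrite mulf_div (mulrC (q - l)) divff ?mulf_neq0 ?subr_eq0 // mulr1 addrC subrK.
Qed.

Let line_lt l p q : l < p -> l < q -> {mono line l p q : x y / x < y}.
Proof.
by move=> lp lq x y; rewrite /line ltrD2l ltr_pM2r ?divr_gt0 ?subr_gt0 // ltrD2r.
Qed.

Let line_gt r p q : p < r -> q < r -> {mono line r p q : x y / x < y}.
Proof.
move=> pr qr x y; rewrite /line ltrD2l ltr_pM2r ?ltrD2r //.
by rewrite -mulrNN -invrN !opprB divr_gt0 ?subr_gt0.
Qed.

Let line0 l p q : line l p q l = l.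
Proof. by rewrite /line subrr mul0r addr0. Qed.

Let line1 l p q : p != l -> line l p q p = q.
Proof. by move=> pl; rewrite /line mulrC divfK ?subr_eq0 // addrC subrK. Qed.

(** Two affine pieces on [l, r], fixing the ends and sending the breakpoint p to q; exchanging p and
    q gives the inverse. *)
Let bump l p q r x :=
  if x <= l then x else if x <= p then line l p q x
  else if x <= r then line r p q x else x.

Let bumpK l p q r : l < p < r -> l < q < r ->
  cancel (bump l p q r) (bump l q p r).
Proof.
move=> /andP[lp pr] /andP[lq qr] x; rewrite {2}/bump.
have ll := line_lt lp lq; have rr := line_gt pr qr.
have lp1 : line l p q p = q by apply: line1; rewrite gt_eqF.
have rp1 : line r p q p = q by apply: line1; rewrite lt_eqF.
have [xl|lx] := leP x l; first by rewrite /bump xl.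
have [xp|px] := leP x p.
  rewrite /bump ifN; last by rewrite -ltNge -[ltLHS](line0 l p q) ll.
  by rewrite ifT ?lineK ?gt_eqF // -[leRHS]lp1 leNgt ll -leNgt.
have [xr|rx] := leP x r.
  rewrite /bump ifN; last first.
    by rewrite -ltNge (lt_trans lq) // -[ltLHS]rp1 rr.
  rewrite ifN; last by rewrite -ltNge -[ltLHS]rp1 rr.
  by rewrite ifT ?lineK ?lt_eqF // -[leRHS](line0 r p q) leNgt rr -leNgt.
by rewrite /bump !ifN // -ltNge // (lt_trans qr).
Qed.

Let bump_homo l p q r : l < p < r -> l < q < r ->
  {homo bump l p q r : x y / x < y}.
Proof.
move=> /andP[lp pr] /andP[lq qr] x y xy; rewrite /bump.
have ll := line_lt lp lq; have rr := line_gt pr qr.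
have lp1 : line l p q p = q by apply: line1; rewrite gt_eqF.
have rp1 : line r p q p = q by apply: line1; rewrite lt_eqF.
have l0 := line0 l p q; have r0 := line0 r p q.
have lle u v : (line l p q u <= line l p q v) = (u <= v).
  by rewrite !leNgt ll.
have rle u v : (line r p q u <= line r p q v) = (u <= v).
  by rewrite !leNgt rr.
case: (leP x l) => xl; case: (leP y l) => yl //; try by move: xl yl xy; lra.
- case: (leP y p) => yp; first by rewrite (le_lt_trans xl) // -[ltLHS]l0 ll.
  case: (leP y r) => yr //; apply: (le_lt_trans xl); apply: (lt_trans lq).
  by rewrite -[ltLHS]rp1 rr.
- case: (leP x p) => xp; case: (leP y p) => yp; try by move: xp yp xy; lra.
  + by rewrite ll.
  + have xq : line l p q x <= q by rewrite -[leRHS]lp1 lle.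
    case: (leP y r) => yr; last exact: (le_lt_trans xq (lt_trans qr yr)).
    by apply: (le_lt_trans xq); rewrite -[ltLHS]rp1 rr.
  case: (leP x r) => xr; case: (leP y r) => yr //; try by move: xr yr xy; lra.
    by rewrite rr.
  by apply: le_lt_trans yr; rewrite -[leRHS]r0 rle.
Qed.

(** Both pieces are given by cross-multiplied equations, which become linear for [lra] once l, p, q,
    r are numerals. *)
Lemma bump_homeo l p q r : 0 <= l -> l < p < r -> l < q < r -> r <= 1 ->
  exists f : homeoI R,
  [/\ supp_in l r f,
      forall x, l <= x <= p -> (p - l) * (act f x - l) = (q - l) * (x - l)
    & forall x, p <= x <= r -> (r - p) * (r - act f x) = (r - q) * (r - x)].
Proof.
move=> l0 pI qI r1.
have out x : ~~ (l < x < r) -> bump l p q r x = x.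
  move=> xn; rewrite /bump; case: leP => // xl; case: leP => [xp|px].
    move: xn pI; rewrite xl /= -leNgt => rx /andP[_ pr].
    by have := le_lt_trans (le_trans rx xp) pr; rewrite ltxx.
  case: leP => // xr; move: xn; rewrite xl /= -leNgt => rx.
  by rewrite (_ : x = r) ?line0 //; apply/eqP; rewrite eq_le xr.
have [||||f fE] := @homeoI_build R (bump l p q r) (bump l q p r).
- exact: bumpK.
- exact: bumpK.
- exact: bump_homo.
- by move=> x xn; apply: out; move: xn l0 r1; lra.
have /andP[lp pr] := pI.
exists f; split=> [x xn|x /andP[lx xp]|x /andP[px xr]]; rewrite fE; first exact: out.
- rewrite /bump xp; case: leP => [xl|_].
    by rewrite (_ : x = l) ?subrr ?mulr0 //; apply/eqP; rewrite eq_le xl.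
  by rewrite /line; field; rewrite subr_eq0 gt_eqF.
- have -> : bump l p q r x = line r p q x.
    rewrite /bump ifN -?ltNge ?(lt_le_trans lp) //.
    case: leP => [xp|_]; last by rewrite xr.
    have -> : x = p by apply/eqP; rewrite eq_le xp.
    by rewrite [LHS]line1 ?[RHS]line1 ?(gt_eqF lp) ?(lt_eqF pr).
  by rewrite /line; field; rewrite subr_eq0 lt_eqF.
Qed.

(* The pair is f0 = b1 and g0 = b1 b2 b3: the bump b2 undoes b1 on [0, 3/32] and
   b3 moves points beyond 7/16 to the left, while neither of them acts on
   [1/4, 7/16]. *)
Lemma base_pair : exists f0 g0 : homeoI R,
  [/\ supp_in 0 (3/4) f0, forall x, 0 < x < 3/4 -> act f0 x < x,
      supp_in (3/32) 1 g0 & forall x, 3/32 < x < 1 -> act g0 x < x] /\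
  [/\ forall x, 1/4 <= x <= 7/16 -> act g0 x = act f0 x,
      act f0 (7/16) <= 1/4,
      act (f0 ^+ 2)%g (3/8) = 3/32
    & act (f0 ^+ 2)%g (act (g0 ^+ 2)%g (3/4)) <= 3/32].
Proof.
(* [b1] halves [0, 1/2], [b2] doubles [0, 3/32], and [b3] sends 3/4 to 1/2. *)
have [||||b1 [s1 l1 r1]] := @bump_homeo 0 (1/2) (1/4) (3/4); try lra.
have [||||b2 [s2 l2 r2]] := @bump_homeo 0 (3/32) (3/16) (1/4); try lra.
have [||||b3 [s3 l3 r3]] := @bump_homeo (7/16) (3/4) (1/2) 1; try lra.
have b1l x : 0 <= x <= 1/2 -> act b1 x = x / 2 by move=> /l1; lra.
have b1lt x : 0 < x < 3/4 -> act b1 x < x.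
  move=> xI; have [x2|x2] := leP x (1/2); first by rewrite b1l; lra.
  by have /r1 : 1/2 <= x <= 3/4; lra.
have b1le x : act b1 x <= x.
  have [/b1lt/ltW//|/s1->//] := boolP (0 < x < 3/4).
have gE x : act (b1 * b2 * b3)%g x = act b1 (act b2 (act b3 x)) by rewrite !actM.
have g1 x : 1/4 <= x <= 7/16 -> act (b1 * b2 * b3)%g x = act b1 x.
  by move=> xI; rewrite gE (s3 x) ?(s2 x) //; lra.
exists b1, (b1 * b2 * b3)%g; do 2!split => //.
- move=> x xn; rewrite gE; have [x1|x1] := ltP x 1; last first.
    by rewrite !(act_out _ (x := x)) //; lra.
  rewrite s3; last by lra.
  have [x0|x0] := leP x 0; first by rewrite s2 ?s1 //; lra.
  have e2 : act b2 x = 2 * x by have /l2 : 0 <= x <= 3/32; lra.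
  by rewrite e2 b1l; lra.
- move=> x xI; rewrite gE; have [x3|x3] := ltP (7/16) x.
    have b3x : act b3 x < x /\ 7/16 <= act b3 x.
      have [x4|x4] := leP x (3/4).
        by have /l3 : 7/16 <= x <= 3/4; lra.
      by have /r3 : 3/4 <= x <= 1; lra.
    by rewrite (s2 (act b3 x)); [have := b1le (act b3 x); lra|lra].
  rewrite (s3 x); last lra.
  have [x4|x4] := leP (1/4) x; first by rewrite s2 ?b1lt //; lra.
  have : 3/32 <= x <= 1/4 by lra.
  by move=> /r2 e2; rewrite b1l; lra.
- by rewrite b1l; lra.
- by rewrite expg2 actM !b1l ?b1l; lra.
(* Applying g0, g0, f0, f0 in turn moves 3/4 to 1/4, 1/8, 1/16 and 1/32, which is at most 3/32. *)
- have e34 : act (b1 * b2 * b3)%g (3/4) = 1/4.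
    have e3 : act b3 (3/4) = 1/2 by have /l3 : 7/16 <= (3/4 : R) <= 3/4; lra.
    by rewrite gE e3 (s2 (1/2)) ?b1l; lra.
  move: e34 g1; move: (b1 * b2 * b3)%g => g e34 g1.
  by rewrite !expg2 !actM e34 g1 ?b1l; lra.
Qed.

End PiecewiseLinear.

(** * Dynamical realization of left-ordered groups *)
Section DenseExtension.
Variables (R : realType) (l r : R) (X : Type) (e : X -> R).
Hypotheses (l0 : 0 <= l) (r1 : r <= 1).
Hypothesis e_itv : forall x, l < e x < r.
Hypothesis e_dense : forall p q, l <= p -> p < q -> q <= r ->
  exists x, p < e x < q.
Implicit Types (x y : X) (u v : R).

Definition e_homo (g : X -> X) := forall x y, e x < e y -> e (g x) < e (g y).

Let image (g : X -> X) u : set R := [set e (g y) | y in [set y | e y < u]].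

Let ext g u := if l < u < r then sup (image g u) else u.

Let extE g u : l < u < r -> ext g u = sup (image g u).
Proof. by rewrite /ext => ->. Qed.

Let image_sup g u : e_homo g -> l < u < r -> has_sup (image g u).
Proof.
move=> gh /andP[lu ur]; split.
  by have [y /andP[_ yu]] := e_dense (lexx l) lu (ltW ur); exists (e (g y)), y.
have [y /andP[uy _]] := e_dense (ltW lu) ur (lexx r).
by exists (e (g y)) => _ [z zu <-]; apply/ltW/gh/(lt_trans zu).
Qed.

(** The inequality is strict because density puts some e z strictly between e y and u. *)
Let ext_ltr g u y : e_homo g -> l < u < r -> e y < u -> e (g y) < ext g u.
Proof.
move=> gh uI yu; have /andP[ly _] := e_itv y; have /andP[_ ur] := uI.
have [z /andP[yz zu]] := e_dense (ltW ly) yu (ltW ur).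
apply: lt_le_trans (gh _ _ yz) _; rewrite extE //; apply: ub_le_sup.
  by case: (image_sup gh uI).
by exists z.
Qed.

Let ext_gtP g u v : e_homo g -> l < u < r -> v < ext g u ->
  exists2 y, e y < u & v < e (g y).
Proof.
move=> gh uI; rewrite extE // => vu; have [h0 _] := image_sup gh uI.
by have [_ [y yu <-] vy] := sup_gt h0 vu; exists y.
Qed.

Let ext_itv g u : e_homo g -> (l < ext g u < r) = (l < u < r).
Proof.
move=> gh; have [uI|uN] := boolP (l < u < r); last by rewrite /ext !(negbTE uN).
have /andP[lu ur] := uI; apply/andP; split.
  have [y /andP[ly yu]] := e_dense (lexx l) lu (ltW ur).
  by apply: lt_trans (ext_ltr gh uI yu); case/andP: (e_itv (g y)).
have [y /andP[uy _]] := e_dense (ltW lu) ur (lexx r).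
apply: (@le_lt_trans _ _ (e (g y))); last by case/andP: (e_itv (g y)).
rewrite extE //; apply: ge_sup; first by case: (image_sup gh uI).
by move=> _ [z zu <-]; apply/ltW/gh/(lt_trans zu).
Qed.

Let ext_le g u v : e_homo g -> u < v -> ext g u <= ext g v.
Proof.
move=> gh uv; have [uI|uN] := boolP (l < u < r).
  have [vI|vN] := boolP (l < v < r).
    rewrite leNgt; apply/negP => /(ext_gtP gh uI)[y yu].
    by rewrite ltNge ltW // ext_ltr // (lt_trans yu).
  rewrite {2}/ext (negbTE vN); have := ext_itv u gh; rewrite uI.
  by move: uI vN uv; lra.
rewrite {1}/ext (negbTE uN); have [vI|vN] := boolP (l < v < r).
  by have := ext_itv v gh; rewrite vI; move: vI uN uv; lra.
by rewrite /ext (negbTE vN) ltW.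
Qed.

(** Together with [ext_id], this turns the inverse of a group element into an inverse bijection of
    the line. *)
Let ext_comp g h u : e_homo g -> e_homo h -> ext (g \o h) u = ext g (ext h u).
Proof.
move=> gh hh; have [uI|uN] := boolP (l < u < r); last by rewrite /ext !(negbTE uN).
have ghh : e_homo (g \o h) by move=> x y /hh/gh.
have hI : l < ext h u < r by rewrite ext_itv.
apply/eqP; rewrite eq_le; apply/andP; split; rewrite leNgt; apply/negP.
  move=> /(ext_gtP ghh uI)[y yu] /=.
  by rewrite ltNge ltW // ext_ltr // ext_ltr.
move=> /(ext_gtP gh hI)[y /(ext_gtP hh uI)[z zu yz]].
by rewrite ltNge ltW // (lt_trans (gh _ _ yz)) // (ext_ltr ghh).
Qed.

Let ext_id u : ext id u = u.
Proof.
have idh : e_homo id by [].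
have [uI|uN] := boolP (l < u < r); last by rewrite /ext (negbTE uN).
have /andP[lu ur] := uI; have := ext_itv u idh; rewrite uI => /andP[lx xr].
apply/eqP; rewrite eq_le; apply/andP; split; rewrite leNgt; apply/negP.
  by move=> /(ext_gtP idh uI)[y yu]; rewrite ltNge ltW.
move=> /[dup] xu /e_dense[||y /andP[xy yu]]; rewrite ?ltW //.
by have := ext_ltr idh uI yu; rewrite ltNge ltW.
Qed.

(* [rho h] sends u to the supremum of the e (h x) with e x < u. *)
Lemma dense_extension (H : groupType) (op : H -> X -> X) :
  (forall h, e_homo (op h)) -> (forall x, op 1%g x = x) ->
  (forall g h x, op (g * h)%g x = op g (op h x)) ->
  exists rho : {multiplicative H -> homeoI R},
    (forall h, supp_in l r (rho h)) /\
    (forall h, rho h = 1%g -> forall x, e (op h x) = e x).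
Proof.
move=> oh o1 oM.
have opK g h : (g * h = 1)%g -> cancel (ext (op h)) (ext (op g)).
  move=> gh u; rewrite -ext_comp // -[RHS]ext_id; congr (ext _ u).
  by apply/funext => x /=; rewrite -oM gh o1.
have f_ex h : exists f : homeoI R, act f =1 ext (op h).
  apply: (@homeoI_build _ _ (ext (op h^-1%g))).
  - by apply: opK; rewrite mulVg.
  - by apply: opK; rewrite mulgV.
  - move=> u v uv; rewrite lt_neqAle ext_le // andbT.
    apply/eqP => /(can_inj (opK h^-1%g h (mulVg h))) uvE.
    by rewrite uvE ltxx in uv.
  - move=> u uN; rewrite /ext ifN //; apply: contra uN => /andP[lu ur].
    by rewrite (le_lt_trans l0 lu) (lt_le_trans ur r1).
pose f h := projT1 (cid (f_ex h)).
have fE h : act (f h) =1 ext (op h) by exact: projT2 (cid (f_ex h)).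
have fM : {morph f : g h / (g * h)%g}.
  move=> g h; apply: act_ext => u; rewrite actM !fE -ext_comp //.
  by congr (ext _ u); apply/funext => x /=; rewrite oM.
pose rho : {multiplicative H -> homeoI R} :=
  HB.pack f (isMultiplicative.Build _ _ f fM).
exists rho; split=> [h u uN|h hE x]; first by rewrite [LHS]fE /ext (negbTE uN).
have ext1 u : ext (op h) u = u by rewrite -fE [f h]hE act1.
have xI := e_itv x; have [/andP[lx xr] /andP[lhx hxr]] := (xI, e_itv (op h x)).
apply/eqP; rewrite eq_le; apply/andP; split; rewrite leNgt; apply/negP.
  move=> /e_dense[||w /andP[xw]]; rewrite ?ltW // -(ext1 (e w)) ltNge ltW //.
  exact: ext_ltr.
rewrite -[in X in _ < X](ext1 (e x)) => /(ext_gtP (oh h) xI)[y /(oh h) yx].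
by rewrite ltNge ltW.
Qed.

End DenseExtension.

(** * Intervals assigned to the elements of a countable left-ordered group *)

Section DynamicalRealization.
Variables (R : realType) (H : groupType) (idx : H -> nat) (leT : rel H).
Hypotheses (idx_inj : injective idx) (leT_anti : antisymmetric leT).
Hypotheses (leT_trans : transitive leT) (leT_total : total leT).
Hypothesis leT_mul : forall x y z, leT x y -> leT (z * x)%g (z * y)%g.
Implicit Types (x y : H) (L : set H) (N : nat).

Let ltT x y := ~~ leT y x.

Let ltTP x y : ltT x y -> leT x y /\ x <> y.
Proof.
rewrite /ltT => nyx; have := leT_total x y; rewrite (negbTE nyx) orbF => xy.
by split=> // xyE; move: nyx xy; rewrite xyE => /negbTE ->.
Qed.

Let ltT_le x y z : ltT x y -> leT y z -> ltT x z.
Proof. by move=> xy yz; apply: contra xy => zx; apply: leT_trans zx. Qed.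

Let ltT_or x y : [\/ ltT x y, x = y | ltT y x].
Proof.
have [xy|] := boolP (leT x y); last by constructor 3.
have [yx|] := boolP (leT y x); last by constructor 1.
by constructor 2; apply: leT_anti; rewrite xy.
Qed.

Let ltTM z x y : ltT x y -> ltT (z * x)%g (z * y)%g.
Proof.
by apply: contra => /(leT_mul z^-1%g); rewrite !mulKg.
Qed.

Let wt n : R := 2^-1 ^+ n.+1.

Let wt_gt0 n : 0 < wt n. Proof. by rewrite exprn_gt0 // invr_gt0. Qed.

(** Since [idx] is only injective, some indices belong to no element and contribute 0. The weights
    2^-(n+1) keep [mass], the total weight of a set, finite. *)
Let term L n : R := if `[< exists2 x, L x & idx x = n >] then wt n else 0.
Let psum L N := \sum_(n < N) term L n.
Let mass L := sup (range (psum L)).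

Let term_ge0 L n : 0 <= term L n.
Proof. by rewrite /term; case: ifP => // _; exact/ltW. Qed.

Let term_in L x : L x -> term L (idx x) = wt (idx x).
Proof. by move=> Lx; rewrite /term asboolT //; exists x. Qed.

Let term_le L L' n : L `<=` L' -> term L n <= term L' n.
Proof.
move=> LL'; rewrite /term; case: asboolP => [[x /LL' Lx xn]|_].
  by rewrite asboolT //; exists x.
by case: ifP => // _; exact/ltW.
Qed.

Let psumS L N : psum L N.+1 = psum L N + term L N.
Proof. by rewrite /psum big_ord_recr. Qed.

Let psum_le L N k : psum L N <= psum L (N + k).
Proof.
elim: k => [|k IH]; first by rewrite addn0.
by rewrite addnS psumS ler_wpDr.
Qed.

(** The subtracted power makes the induction work: a weight is at most 2^-(n+1) = 2^-n -
    2^-(n+1). *)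
Let psum_tail L N k : psum L (N + k) <= psum L N + 2^-1 ^+ N - 2^-1 ^+ (N + k).
Proof.
elim: k => [|k IH]; first by rewrite addn0 addrK.
rewrite addnS psumS; have : term L (N + k) <= wt (N + k).
  by rewrite /term; case: ifP => // _; exact/ltW.
by rewrite /wt exprS; move: IH; lra.
Qed.

Let psum_bound L N M : psum L M <= psum L N + 2^-1 ^+ N.
Proof.
have h k : 0 < 2^-1 ^+ k :> R by rewrite exprn_gt0 // invr_gt0.
have [/subnKC<-|/ltnW/subnKC<-] := leqP N M.
  by have := psum_tail L N (M - N); have := h (N + (M - N))%N; lra.
by have := psum_le L M (N - M); have := h (M + (N - M))%N; lra.
Qed.

Let psum_mass L N : psum L N <= mass L.
Proof.
apply: ub_le_sup; last by exists N.
by exists (psum L 0 + 2^-1 ^+ 0) => _ [M _ <-]; exact: psum_bound.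
Qed.

Let mass_le L (v : R) : (forall N, psum L N <= v) -> mass L <= v.
Proof. by move=> Lv; apply: ge_sup => [|_ [N _ <-]] //; exists (psum L 0), 0%N. Qed.

(* [x] receives an interval of length [w x], to the right of those of all the
   smaller elements; [tau x] is its left end. *)
Let tau x := mass [set y | ltT y x].
Let w x := wt (idx x).

Let psum_cover L L' L'' N : L'' `<=` L `|` L' ->
  psum L'' N <= psum L N + psum L' N.
Proof.
move=> cov; rewrite /psum -big_split /=; apply: ler_sum => n _.
rewrite {1}/term; case: asboolP => [[x /cov[Lx|Lx] <-]|_]; last exact: addr_ge0.
  by rewrite (term_in Lx) lerDl.
by rewrite (term_in Lx) lerDr.
Qed.

Let psum_disj L L' L'' N : L `<=` L'' -> L' `<=` L'' ->
  (forall x, L x -> L' x -> False) -> psum L N + psum L' N <= psum L'' N.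
Proof.
move=> LL LL' disj; rewrite /psum -big_split /=; apply: ler_sum => n _.
rewrite /term; case: asboolP => [[x Lx <-]|_]; last first.
  by rewrite add0r; exact: term_le.
rewrite asboolF ?asboolT ?addr0 //; first by exists x => //; exact: LL.
by move=> [y L'y /idx_inj yx]; apply: (disj x) => //; rewrite -yx.
Qed.

Let psum1 x N : psum [set x] N = if (idx x < N)%N then w x else 0.
Proof.
elim: N => [|N IH]; first by rewrite /psum big_ord0.
rewrite psumS IH /term; case: asboolP => [[y /= -> yN]|xN].
  by rewrite yN ltnn ltnSn add0r /w yN.
by rewrite addr0 [in RHS]ltnS [in RHS]leq_eqVlt; case: eqP => //= xE; case: xN; exists x.
Qed.

Let psum_down x N : psum [set y | leT y x] N <= tau x + w x.
Proof.
have cov : [set y | leT y x] `<=` [set y | ltT y x] `|` [set x].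
  by move=> y /= yx; case: (ltT_or y x) => [|->|]; [left|right|rewrite /ltT yx].
apply: (le_trans (psum_cover N cov)).
apply: lerD; first exact: psum_mass.
by rewrite psum1; case: ifP => // _; exact/ltW/wt_gt0.
Qed.

Let tau_jump x y : ltT x y -> tau x + w x <= tau y.
Proof.
move=> xy; rewrite -lerBrDr; apply: mass_le => N; rewrite lerBrDr.
(* The partial sum goes past the index of x, so that it counts w x in full. *)
have := psum_mass [set z | ltT z y] (N + (idx x).+1).
apply: le_trans.
have -> : w x = psum [set x] (N + (idx x).+1).
  by rewrite psum1 addnS ltnS leq_addl.
apply: le_trans (lerD (psum_le _ _ _) (lexx _)) _.
apply: psum_disj => [z /= zx|z /= ->//|z /= zx xE].
- by apply: (ltT_le zx); case: (ltTP xy).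
- by move: zx; rewrite xE /ltT; have := leT_total x x; rewrite orbb => ->.
Qed.

Let total_mass := mass setT.

Let tau_ge0 x : 0 <= tau x.
Proof. by have := psum_mass [set y | ltT y x] 0; rewrite /psum big_ord0. Qed.

Let tau_le_total x : tau x + w x <= total_mass.
Proof.
rewrite -lerBrDr; apply: mass_le => N; rewrite lerBrDr.
have := psum_mass setT (N + (idx x).+1).
apply: le_trans.
have -> : w x = psum [set x] (N + (idx x).+1).
  by rewrite psum1 addnS ltnS leq_addl.
apply: le_trans (lerD (psum_le _ _ _) (lexx _)) _.
apply: psum_disj => // z /= zx xE.
by move: zx; rewrite xE /ltT; have := leT_total x x; rewrite orbb => ->.
Qed.

(** Only finitely many elements have index below N, so a nonempty truncation has a greatest element
    even if [D] has none. The order [o] is a parameter in order to obtain least elements too. *)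
Let max_ex (D : set H) N (o : rel H) : transitive o -> total o ->
  (forall x, D x -> ~ (idx x < N)%N) \/
  exists x, [/\ D x, (idx x < N)%N & forall y, D y -> (idx y < N)%N -> o y x].
Proof.
move=> ot oo; elim: N => [|N [IH|[x [Dx xN xmax]]]]; first by left.
- have [[x Dx xN]|nx] := pselect (exists2 x, D x & idx x = N).
    right; exists x; split; rewrite ?xN // => y Dy.
    rewrite ltnS leq_eqVlt => /orP[/eqP|/IH]; last by move=> /(_ Dy).
    by rewrite -xN => /idx_inj ->; have := oo x x; rewrite orbb.
  left=> x Dx; rewrite ltnS leq_eqVlt => /orP[/eqP xN|]; last exact: IH.
  by apply: nx; exists x.
- have [[z Dz zN]|nz] := pselect (exists2 x, D x & idx x = N).
    have zmax y : D y -> (idx y < N.+1)%N -> y = z \/ o y x.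
      move=> Dy; rewrite ltnS leq_eqVlt => /orP[/eqP|]; last by right; exact: xmax.
      by rewrite -zN => /idx_inj ->; left.
    have /orP[zx|xz] := oo z x.
      by right; exists x; split=> // [|y Dy /zmax[//|->|]//]; exact: leqW.
    right; exists z; split; rewrite ?zN // => y Dy /zmax[//|->|yx].
      by have := oo z z; rewrite orbb.
    exact: ot xz.
  right; exists x; split=> // [|y Dy]; first exact: leqW.
  rewrite ltnS leq_eqVlt => /orP[/eqP yN|]; last exact: xmax.
  by case: nz; exists y.
Qed.

Let psum_empty L N : (forall x, L x -> ~ (idx x < N)%N) -> psum L N = 0.
Proof.
move=> nL; rewrite /psum big1 // => n _; rewrite /term asboolF //.
by move=> [x Lx xn]; apply: (nL x Lx); rewrite xn.
Qed.

Let psum_restrict L L' N : (forall x, L x -> (idx x < N)%N -> L' x) ->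
  psum L N <= psum L' N.
Proof.
move=> LL'; apply: ler_sum => n _; rewrite {1}/term.
case: asboolP => // -[x Lx xn]; rewrite -xn term_in //.
by apply: LL' => //; rewrite xn.
Qed.

(* If (p, q) met no interval [tau x, tau x + w x], each of these would lie on
   one side of it; but their total length is the whole mass. *)
Let tau_dense (p q : R) : 0 <= p -> p < q -> q <= total_mass ->
  exists x, p < tau x + w x /\ tau x < q.
Proof.
move=> p0 pq qS; apply: contrapT => /forallNP no.
have side x : tau x + w x <= p \/ q <= tau x.
  have [|px] := leP (tau x + w x) p; first by left.
  by right; rewrite leNgt; apply/negP => xq; apply: (no x).
pose D := [set x | tau x + w x <= p]; pose U := [set x | q <= tau x].
(* Truncation at N costs 2^-N twice: once in [psumU] and once in bounding the total mass. *)
have [N Nq] : exists N, 2 * 2^-1 ^+ N < q - p :> R.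
  pose M := Num.bound (2 / (q - p)); exists M.
  have qp : 0 < q - p by rewrite subr_gt0.
  have M0 : 2 / (q - p) < M%:R by rewrite archi_boundP // divr_ge0 // ltW.
  have M1 : 2 / (q - p) < 2 ^+ M.
    by apply: lt_trans M0 _; rewrite -natrX ltr_nat ltn_expl.
  rewrite exprVn ltr_pdivrMr ?exprn_gt0 // mulrC -ltr_pdivrMr //.
(* The truncation of D lies below its greatest element x, hence weighs at most tau x + w x <= p. *)
have psumD : psum D N <= p.
  have [nD|[x [Dx xN xmax]]] := @max_ex D N leT leT_trans leT_total.
    by rewrite psum_empty.
  apply: le_trans Dx.
  apply: le_trans (psum_down x N).
  exact: psum_restrict.
(* The truncation of U lies above its least element x, and what precedes x weighs tau x >= q, up to
   2^-N. *)
have psumU : psum U N + q <= total_mass + 2^-1 ^+ N.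
  have geT_trans : transitive (fun x y => leT y x).
    by move=> y x z yx zy; exact: leT_trans zy yx.
  have geT_total : total (fun x y => leT y x) by move=> x y; rewrite leT_total.
  have [nU|[x [Ux xN xmin]]] := @max_ex U N _ geT_trans geT_total.
    rewrite psum_empty // add0r; apply: le_trans qS _.
    by rewrite lerDl exprn_ge0 // invr_ge0.
  have UT : psum U N <= psum [set y | leT x y] N by exact: psum_restrict.
  have split_x : psum [set y | leT x y] N + psum [set y | ltT y x] N <= psum setT N.
    by apply: psum_disj => // y xy /=; rewrite /ltT xy.
  have xq : tau x <= psum [set y | ltT y x] N + 2^-1 ^+ N.
    by apply: mass_le => M; exact: psum_bound.
  have := psum_mass setT N; rewrite -/total_mass.
  by move: UT split_x xq Ux; rewrite /U /=; lra.
have cov : setT `<=` D `|` U by move=> x _; case: (side x); [left|right].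
have := psum_cover N cov; have : total_mass <= psum setT N + 2^-1 ^+ N.
  by apply: mass_le => M; exact: psum_bound.
by move: psumD psumU Nq; lra.
Qed.

(** H acts on H x (0, 1) by left multiplication of the first factor, and (x, s) is placed at tau x +
    s w x, rescaled to (l, r). Left invariance makes this action increasing and [tau_dense] makes
    the placement dense, so the action extends. A nontrivial x moves the interval of 1 off itself,
    whence faithfulness. *)
Lemma dynamical_realization (l r : R) : 0 <= l -> l < r -> r <= 1 ->
  exists rho : {multiplicative H -> homeoI R},
    injective rho /\ forall x, supp_in l r (rho x).
Proof.
move=> l0 lr r1.
pose X := (H * {s : R | 0 < s < 1})%type.
have T0 : 0 < total_mass.
  by have := tau_le_total 1%g; have := tau_ge0 1%g; have := wt_gt0 (idx 1%g); rewrite /w; lra.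
pose e0 (z : X) := tau z.1 + sval z.2 * w z.1.
pose e (z : X) := l + e0 z * ((r - l) / total_mass).
have k0 : 0 < (r - l) / total_mass by rewrite divr_gt0 ?subr_gt0.
have e_lt z z' : (e z < e z') = (e0 z < e0 z') by rewrite /e ltrD2l ltr_pM2r.
have e0_itv z : tau z.1 < e0 z < tau z.1 + w z.1.
  case: z => x [s sI]; rewrite /e0 /=; have /andP[s0 s1] := sI.
  by rewrite ltrDl ltrD2l mulr_gt0 ?wt_gt0 //= gtr_pMl ?wt_gt0.
have e0_lt z z' : ltT z.1 z'.1 -> e0 z < e0 z'.
  move=> /tau_jump zz'; have /andP[_ h1] := e0_itv z.
  by have /andP[h2 _] := e0_itv z'; apply: lt_trans h1 (le_lt_trans zz' h2).
have e_itv z : l < e z < r.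
  have /andP[z1 z2] := e0_itv z.
  have z0 : 0 < e0 z by exact: le_lt_trans (tau_ge0 _) z1.
  have zT : e0 z < total_mass by exact: lt_le_trans z2 (tau_le_total _).
  rewrite /e ltrDl mulr_gt0 //= -ltrBrDl mulrCA gtr_pMr ?subr_gt0 //.
  by rewrite ltr_pdivrMr ?mul1r.
have e_dense p q : l <= p -> p < q -> q <= r -> exists z, p < e z < q.
  move=> lp pq qr.
  pose c v := (v - l) * (total_mass / (r - l)).
  have k1 : 0 < total_mass / (r - l) by rewrite divr_gt0 ?subr_gt0.
  have ck v : v = l + c v * ((r - l) / total_mass).
    rewrite /c; field; rewrite !gt_eqF ?subr_gt0 //.
  have [|||x [px xq]] := @tau_dense (c p) (c q).
  - by rewrite mulr_ge0 ?subr_ge0 // ltW.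
  - by rewrite ltr_pM2r // ltrD2r.
  - rewrite /c mulrCA ger_pMr // ler_pdivrMr ?subr_gt0 // mul1r lerD2r //.
  have wx := wt_gt0 (idx x); rewrite -/(w x) in wx.
  have cpq : c p < c q by rewrite ltr_pM2r // ltrD2r.
  (* [c] inverts the rescaling, and (m, M) is the overlap of (c p, c q) with the interval of x. Its
     midpoint v has relative position s = (v - tau x) / w x. *)
  pose m := Num.max (c p) (tau x); pose M := Num.min (c q) (tau x + w x).
  have mM : m < M by rewrite lt_min !gt_max cpq px xq ltrDl wx.
  pose v := (m + M) / 2.
  have mv : m < v by rewrite midf_lt.
  have vM : v < M by rewrite midf_lt.
  move: mv vM; rewrite gt_max lt_min => /andP[pv tv] /andP[vq vt].
  have sI : 0 < (v - tau x) / w x < 1.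
    by rewrite divr_gt0 ?subr_gt0 //= ltr_pdivrMr // mul1r ltrBlDl.
  exists (x, exist (fun s : R => 0 < s < 1) _ sI).
  rewrite {1}(ck p) {1}(ck q) /e /e0 /= divfK ?gt_eqF //.
  by rewrite subrKC !ltrD2l !ltr_pM2r // pv vq.
pose op (x : H) (z : X) : X := ((x * z.1)%g, z.2).
have [||//|rho [rho_supp rho1]] := dense_extension l0 r1 e_itv e_dense (op := op).
- move=> x [y s] [y' s']; rewrite !e_lt => yy.
  have [yy'|yE|y'y] := ltT_or y y'.
  + exact/e0_lt/ltTM.
  + move: yy; rewrite /e0 /op -yE /= !ltrD2l !ltr_pM2r ?wt_gt0 //.
  + by have := e0_lt (y', s') (y, s) y'y; rewrite ltNge ltW.
- by case=> y s; rewrite /op mul1g.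
- by move=> x x' z; rewrite /op mulgA.
have half : 0 < (2^-1 : R) < 1 by lra.
exists rho; split=> //; apply: mult_inj => x.
move=> /rho1/(_ (1%g, exist (fun s : R => 0 < s < 1) _ half)) ee.
have nlt z z' : e z = e z' -> ~ ltT z.1 z'.1.
  by move=> zz /e0_lt; rewrite -e_lt zz ltxx.
case: (ltT_or x 1%g) => // [|] x1.
- by case: (nlt _ _ ee); rewrite /op /= mulg1.
- by case: (nlt _ _ (esym ee)); rewrite /op /= mulg1.
Qed.

End DynamicalRealization.

(** * Embedding H in a square root *)
Section SupportSets.
Variable R : realType.
Implicit Types (f g : homeoI R) (l r x : R).

Lemma supportE f : Defs.support f = [set x | act f x <> x].
Proof.
apply/seteqP; split=> [_ [u /= fu <-]|x /= fx].
  by rewrite act_val => /val_inj.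
have [/unitI_ex[u ux]|xn] := boolP (0 <= x <= 1); last by case: fx; rewrite act_notin.
by exists u => // fu; apply: fx; rewrite -ux act_val fu.
Qed.

(** An increasing map has no 2-cycle: if f x < x, then f (f x) < f x < x, and dually. *)
Lemma act_sqr_fix f x : act (f ^+ 2)%g x = x -> act f x = x.
Proof.
rewrite expg2 actM => ffx; case: (ltgtP (act f x) x) => // h;
  by have := h; rewrite -(act_lt f) ffx => /(lt_trans h); rewrite ltxx.
Qed.

Lemma support_itv l r f :
  supp_in l r f -> (forall x, l < x < r -> act f x < x) ->
 Defs.support f = `]l, r[%classic.
Proof.
move=> fl fr; rewrite supportE; apply/seteqP; split=> x /=; rewrite in_itv /=.
  by move=> fx; apply/negP => /negP/fl.
by move=> /fr fx xE; rewrite xE ltxx in fx.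
Qed.

Lemma two_chain_itv (a b c d : R) : a < b -> b < c -> c < d ->
  two_chain `]a, c[%classic `]b, d[%classic.
Proof.
move=> ab bc cd.
have oi (p q : R) : p < q -> open_interval `]p, q[%classic.
  move=> pq; split; [exact: interval_open|exact: interval_is_interval|].
  by exists ((p + q) / 2); rewrite /= in_itv /= !midf_lt.
have bcE : `]a, c[%classic `&` `]b, d[%classic = `]b, c[%classic :> set R.
  apply/seteqP; split=> x; rewrite /= !in_itv /=.
    by case=> /andP[_ ->] /andP[->].
  by move=> /andP[bx xc]; rewrite bx xc (lt_trans ab) // (lt_trans xc).
have [ob ib eb] := oi _ _ bc.
rewrite /two_chain bcE; split.
- exact/oi/(lt_trans ab).
- exact/oi/(lt_trans bc).
- by split.
- split=> [x|/(_ ((a + b) / 2))]; rewrite /= !in_itv /=.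
    by move=> /andP[bx ->]; rewrite (lt_trans ab).
  by move=> /(_ _)/andP[]; [move: ab bc; lra|move: ab bc; lra].
- split=> [x|/(_ ((c + d) / 2))]; rewrite /= !in_itv /=.
    by move=> /andP[-> xc]; rewrite (lt_trans xc).
  by move=> /(_ _)/andP[]; [move: bc cd; lra|move: bc cd; lra].
Qed.

Lemma commute_supp l r f g : supp_in l r f ->
  (forall x, l < x < r -> act g x = x) -> commute f g.
Proof.
move=> sf gx; apply: act_ext => x; rewrite !actM.
have [xI|xn] := boolP (l < x < r); first by rewrite !gx ?supp_itv.
rewrite (sf x) // sf //; apply: contra xn => gI.
by have /(@act_inj _ g) <- := gx _ gI.
Qed.

End SupportSets.

(** Each element is the value of a word in the two generators and their inverses, coded by pairs of
    booleans; a chosen word is then numbered by [pickle]. *)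
Lemma gen2_countable (G : groupType) (x y : G) :
  gen_subgroup [set x; y] = [set: G] -> exists idx : G -> nat, injective idx.
Proof.
move=> gG; pose letter (i : bool * bool) :=
  let s := if i.1 then x else y in if i.2 then s else s^-1%g.
pose word (w : seq (bool * bool)) := foldr (fun i z => letter i * z)%g 1%g w.
pose K := [set z | (forall w, range word (z * word w)%g) /\
  (forall w, range word (z^-1 * word w)%g)].
have Kg : is_subgroup K.
  split=> [|u v [u1 u2] [v1 v2]|u [u1 u2]]; split=> w.
  - by rewrite mul1g; exists w.
  - by rewrite invg1 mul1g; exists w.
  - by rewrite -mulgA; have [w' _ <-] := v1 w.
  - by rewrite invgM -mulgA; have [w' _ <-] := u2 w.
  - exact: u2.
  - by rewrite invgK; exact: u1.
have KG z : K z.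
  apply: (gen_min Kg (S := [set x; y])); last by rewrite gG.
  move=> _ [->|->]; split=> w.
  - by exists ((true, true) :: w).
  - by exists ((true, false) :: w).
  - by exists ((false, true) :: w).
  - by exists ((false, false) :: w).
have ex z : exists w, word w = z.
  by have [/(_ [::]) [w _ we] _] := KG z; exists w; rewrite we mulg1.
pose f z := projT1 (cid (ex z)); exists (fun z => pickle (f z)).
apply: (can_inj (g := fun n => if unpickle n is Some w then word w else 1%g)) => z.
by rewrite pickleK; exact: projT2 (cid (ex z)).
Qed.

(** Once one generator goes to 1 the image is cyclic, so the relators, being commutators, are
    killed. *)
Lemma thompsonF_abel_lift (G : groupType) (x : G) :
  (exists phi : {multiplicative thompsonF -> G}, phi F_a = x /\ phi F_b = 1%g) /\
  (exists phi : {multiplicative thompsonF -> G}, phi F_a = 1%g /\ phi F_b = x).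
Proof.
split; apply: thompsonF_lift; rewrite ?conj1g ?expg2 ?mul1g ?conjg1 ?mulg1.
- exact: commute1.
- exact: commute1.
- exact/commute_sym/commuteV.
- exact/commute_sym/commuteV.
Qed.

(* Conjugation by [t] shifts glued sequences, so the commutator of [t] with a
   sequence that is constant up to -1 and trivial from 1 on only involves the
   indices -1 and 0. *)
Section GluedPair.
Variables (R : realType) (t : homeoI R) (l r : R) (x y : homeoI R).
Hypotheses (lr : l < r) (trl : act t r <= l).
Hypotheses (xs : supp_in l r x) (ys : supp_in l r y).

Definition pair_seq (n : int) : homeoI R :=
  if n == 0 then x else if n == -1 then y else 1%g.

Definition stair_seq (n : int) : homeoI R :=
  if 0 < n then 1%g else if n == 0 then x else (x * y)%g.

Let pair_adm : admissible l r pair_seq.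
Proof. by move=> n; rewrite /pair_seq; do 2?case: ifP => // _; exact: supp_in1. Qed.

Lemma stair_admissible : admissible l r stair_seq.
Proof.
move=> n; rewrite /stair_seq; do 2?case: ifP => // _; first exact: supp_in1.
exact: supp_inM.
Qed.

(** Conjugated by t^-1, the commutator is u^-1 times the shift of u, with u the glued stair s. Its
    term s(n)^-1 s(n - 1) is x at n = 1, y at n = 0 and 1 elsewhere: the pair shifted by one. *)
Lemma commg_stair :
  [~ t, shift_glue t l r stair_seq]%g = shift_glue t l r pair_seq.
Proof.
have sh := glue_shift lr trl.
have sv : admissible l r (fun n => (stair_seq n)^-1%g).
  by move=> n; apply/supp_inV/stair_admissible.
apply: (mulIg t^-1%g); apply: (mulgI t); rewrite mulgA [RHS]mulgA sh //.
have -> : (t * [~ t, shift_glue t l r stair_seq] * t^-1 =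
    (shift_glue t l r stair_seq)^-1 * (t * shift_glue t l r stair_seq * t^-1))%g.
  by rewrite /commg /conjg !mulgA mulgV mul1g.
rewrite sh -?shift_glueV -?shift_glueM //;
  try by [exact: stair_admissible | move=> n; exact: stair_admissible].
congr shift_glue; apply/funext => n; rewrite /stair_seq /pair_seq.
have [n1|[->|[->|n1]]] : (1 < n) \/ n = 1 \/ n = 0 \/ n < 0 by lia.
- have [-> -> -> ->] : [/\ (0 < n) = true, (0 < n - 1) = true, (n - 1 == 0) = false
      & (n - 1 == -1) = false] by split; lia.
  by rewrite invg1 mulg1.
- by rewrite /= invg1 mul1g.
- by rewrite /= mulKg.
have [-> -> -> [-> ->]] : [/\ (0 < n) = false, (0 < n - 1) = false, (n == 0) = false
    & (n - 1 == 0) = false /\ (n - 1 == -1) = false] by do !split; lia.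
exact: mulVg.
Qed.

(* This is where a map to F is needed: it provides homomorphisms H -> <y> and
   H -> <x> with values (y, 1) and (1, x) at (h1, h2). *)
Lemma glued_pair_embedding (H : groupType) (h1 h2 : H)
    (chi : {multiplicative H -> thompsonF})
    (rho : {multiplicative H -> homeoI R}) :
  gen_subgroup [set h1; h2] = [set: H] -> chi h1 = F_a -> chi h2 = F_b ->
  injective rho -> (forall h, supp_in l r (rho h)) -> rho h1 = x -> rho h2 = y ->
  exists2 theta : {multiplicative H -> homeoI R}, injective theta &
    range theta `<=` gen_subgroup [set shift_glue t l r pair_seq; t].
Proof.
move=> Hgen chi1 chi2 rho_inj rho_supp rho1 rho2.
have [[la [la1 la2]] _] := thompsonF_abel_lift y.
have [_ [lb [lb1 lb2]]] := thompsonF_abel_lift x.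
have supp_grp (k : {multiplicative thompsonF -> homeoI R}) :
    is_subgroup [set u | supp_in l r (k u)].
  split=> [|u v|u] /=; first by rewrite mult1; exact: supp_in1.
    by rewrite gmulfM; exact: supp_inM.
  by rewrite multV; exact: supp_inV.
have las u : supp_in l r (la u).
  apply: (thompsonF_ind (K := [set u | supp_in l r (la u)])) => //=.
    by rewrite la1.
  by rewrite la2; exact: supp_in1.
have lbs u : supp_in l r (lb u).
  apply: (thompsonF_ind (K := [set u | supp_in l r (lb u)])) => //=.
    by rewrite lb1; exact: supp_in1.
  by rewrite lb2.
(* At the indices -1, 0, 1 this gives (y, x, 1) for h1, which is the pair, and (1, y, x) for h2,
   which is its conjugate by t. *)
pose sq (h : H) (n : int) : homeoI R := if n == 0 then rho h else
  if n == -1 then la (chi h) else if n == 1 then lb (chi h) else 1%g.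
have sq_adm h : admissible l r (sq h).
  by move=> n; rewrite /sq; do 3?case: ifP => // _; exact: supp_in1.
pose f h := shift_glue t l r (sq h).
have fM : {morph f : g h / (g * h)%g}.
  move=> g h; rewrite /f -shift_glueM //; congr shift_glue; apply/funext => n.
  by rewrite /sq; do 3?case: ifP => _; rewrite ?gmulfM ?mulg1.
have [theta thetaE] : exists theta : {multiplicative H -> homeoI R}, theta =1 f.
  pose theta : {multiplicative H -> homeoI R} :=
    HB.pack f (isMultiplicative.Build _ _ f fM).
  by exists theta.
have f1 : f h1 = shift_glue t l r pair_seq.
  congr shift_glue; apply/funext => n; rewrite /sq /pair_seq rho1 chi1 la1 lb1.
  by do 3?case: ifP => // _.
have f2 : f h2 = (t * shift_glue t l r pair_seq * t^-1)%g.
  rewrite glue_shift //; congr shift_glue; apply/funext => n.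
  rewrite /sq /pair_seq rho2 chi2 la2 lb2.
  have [->|[->|[->|nn]]] : n = 0 \/ n = 1 \/ n = -1 \/
      (n != 0) && (n != 1) && (n != -1) by lia.
  - by [].
  - by [].
  - by [].
  by rewrite !ifN //; lia.
exists theta.
  apply: mult_inj => h th.
  (* The term of index 0 alone decides injectivity, as [rho] is faithful. *)
  have : shift_glue t l r (sq h) = shift_glue t l r (fun=> 1%g).
    by rewrite shift_glue1 -th thetaE.
  move/(glue_inj lr trl (sq_adm h) (fun=> @supp_in1 R l r))/(_ 0).
  by rewrite /sq /= -(mult1 rho) => /rho_inj.
set K := gen_subgroup _.
have Ks : K (shift_glue t l r pair_seq) by apply: gen_in; left.
have Kt : K t by apply: gen_in; right.
have KP : is_subgroup [set h | K (theta h)].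
  split=> [|g h|h] /=.
  - by rewrite mult1; exact: gen1.
  - by rewrite gmulfM; exact: genM.
  - by rewrite multV; exact: genV.
move=> _ [h _ <-]; apply: (gen_min KP (S := [set h1; h2])); last by rewrite Hgen.
move=> _ [->|->] /=; first by rewrite thetaE f1.
by rewrite thetaE f2; apply: genM; [exact: genM|exact: genV].
Qed.

End GluedPair.

(* [y] is [u] on (l, r) and alternately a conjugate of u^-1 and of u on its
   translates by [f0]; so [f0] conjugates [y] to y^-1, and (f0 y)^2 = f0^2. *)
Section SquareRootTwist.
Variables (R : realType) (f0 : homeoI R) (l r : R) (u : homeoI R).
Hypotheses (lr : l < r) (f0r : act f0 r <= l) (us : supp_in l r u).

Let alt_seq (n : int) : homeoI R := if odd `|n|%N then u^-1%g else u.

Let alt_adm : admissible l r alt_seq.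
Proof. by move=> n; rewrite /alt_seq; case: ifP => // _; exact: supp_inV. Qed.

Lemma twisted_root : exists y : homeoI R,
  ((f0 * y) ^+ 2 = f0 ^+ 2)%g /\ (forall t, supp_in l r t -> (t ^ y = t ^ u)%g).
Proof.
pose y := shift_glue f0 l r alt_seq; exists y.
have f0y : (f0 * y * f0^-1 = y^-1)%g.
  rewrite glue_shift // -shift_glueV //; congr shift_glue; apply/funext => n.
  rewrite /alt_seq (_ : odd `|n - 1|%N = ~~ odd `|n|%N); last by lia.
  by case: odd; rewrite //= invgK.
split=> [|t ts].
  have f0yE : (f0 * y = y^-1 * f0)%g by rewrite -f0y mulgVK.
  by rewrite !expg2 {2}f0yE mulgA mulgK.
have dadm : admissible l r (fun n => if n == 0 then t else 1%g).
  by move=> n; case: ifP => // _; exact: supp_in1.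
have yadm : admissible l r (fun n => (alt_seq n)^-1%g).
  by move=> n; exact: supp_inV.
(* As a glued element t is concentrated at index 0, where y is u; at every other index the two
   factors from y cancel. *)
rewrite -{1}(glue_delta lr f0r ts) -(glue_delta lr f0r (supp_inJ ts us)).
rewrite /conjg -shift_glueV // -!shift_glueM //; last by move=> n; exact: supp_inM.
congr shift_glue; apply/funext => n; case: eqP => [->//|_].
by rewrite mul1g mulVg.
Qed.

End SquareRootTwist.

Theorem theorem1p5 (R : realType) (H : groupType) (h1 h2 : H)
    (hH : marked_extension_of_P h1 h2) (hlo : left_orderable H) :
  exists G : set (homeoI R), is_square_root_of_F G /\ embeds_in_subgroup H G.
Proof.
case: hH => Hgen [phi [_ phi1 phi2]]; case: hlo => le [le_anti le_trans le_tot le_mul].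
have [idx idx_inj] := gen2_countable Hgen.
have [f0 [g0 [[f0s f0lt g0s g0lt] [fg f0r f0d fast]]]] := base_pair R.
pose A := (f0 ^+ 2)%g; pose B := (g0 ^+ 2)%g.
have Afix x : 3/4 <= x -> act A x = x.
  by move=> x4; rewrite actM !f0s //; lra.
have Amove x : 0 < x -> x < 3/4 -> act A x < x.
  move=> x0 x4; have fx := f0lt x; rewrite x0 x4 in fx.
  by rewrite actM; apply: lt_trans (fx isT); rewrite act_lt fx.
have Bfix x : x <= 3/32 -> act B x = x.
  by move=> x4; rewrite actM !g0s //; lra.
have Bmove x : 3/32 < x -> x < 1 -> act B x < x.
  move=> x0 x4; have fx := g0lt x; rewrite x0 x4 in fx.
  by rewrite actM; apply: lt_trans (fx isT); rewrite act_lt fx.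
have a0 : 0 < 3/32 :> R by lra.
have ab : 3/32 < 3/4 :> R by lra.
have b1 : 3/4 < 1 :> R by lra.
have AF := fast_chain_F a0 ab b1 Afix Amove Bfix Bmove fast.
(* The left end A^-1 alpha is 3/8, so t0 can be confined to (3/8, 7/16), where f0 and g0 agree. *)
have dE : act A^-1%g (3/32) = 3/8 by rewrite -f0d actK.
have [|t0 [t0AB t0s t0n1]] :=
  @chain_small_element _ _ _ _ _ ab b1 Afix Amove Bfix Bmove fast (7/16).
  by rewrite dE; lra.
rewrite dE in t0s.
have [t [tAB ts [x0 tx0]]] : exists t, [/\ gen_subgroup [set A; B] t,
    supp_in (3/8) (7/16) t & exists x, act t x < x].
  have [x xn] : exists x, act t0 x <> x.
    apply: contrapT => /forallNP no; apply: t0n1; apply: act_ext => x.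
    by rewrite act1; apply: contrapT; exact: no.
  (* If t0 moves x to the right, its inverse moves x to the left. *)
  case: (ltgtP (act t0 x) x) xn => // tx _; first by exists t0; split=> //; exists x.
  exists t0^-1%g; split; [exact: genV|exact: supp_inV|exists x].
  by rewrite actVlt.
have x0I : 3/8 < x0 < 7/16.
  by apply/negP => /negP/ts tE; rewrite tE ltxx in tx0.
have tx0I : 3/8 < act t x0 < 7/16 by rewrite supp_itv.
(* J is (j, x0): t sends its right end to its left end, so the translates of J by t are disjoint. *)
set j := act t x0 in tx0I tx0.
have [|||rho [rho_inj rho_supp]] :=
  @dynamical_realization R H idx le idx_inj le_anti le_trans le_tot le_mul j x0;
  try by move: x0I tx0I tx0; lra.
have tr : act t x0 <= j by [].
have st_adm := stair_admissible (rho_supp h1) (rho_supp h2).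
set st := stair_seq (rho h1) (rho h2) in st_adm.
pose u := shift_glue t j x0 st.
have us : supp_in (3/8) (7/16) u.
  move=> x xn; apply: (glue_fix tx0 tr st_adm (ts x xn)).
  by move: xn x0I tx0I; lra.
have sub (h : homeoI R) : supp_in (3/8) (7/16) h -> supp_in (1/4) (7/16) h.
  by apply: supp_in_sub; lra.
(* The twist is glued along the translates of (1/4, 7/16) by f0, disjoint because f0 (7/16) <=
   1/4. *)
have [|y [f2 yt]] := twisted_root _ f0r (sub _ us); first by lra.
pose f := (f0 * y)%g.
pose G := gen_subgroup [set f; g0]; exists G.
have Gf : G f by apply: gen_in; left.
have Gg : G g0 by apply: gen_in; right.
split.
  exists f, g0; split=> //; first by rewrite f2.
  (* The support is read off from f^2 = f0^2, as an increasing map moves a point to the left exactly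
     when its square does. *)
  have sf : supp_in 0 (3/4) f.
    move=> x xn; apply: act_sqr_fix; rewrite f2 expg2 actM.
    by rewrite !(f0s x).
  have flt x : 0 < x < 3/4 -> act f x < x.
    move=> /andP[x0' x4]; have := Amove x x0' x4; rewrite /A -f2 expg2 actM.
    case: (ltgtP (act f x) x) => // h; last by rewrite !h ltxx.
    move=> ffx; have h' : act f x < act f (act f x) by rewrite act_lt.
    by have := lt_trans h (lt_trans h' ffx); rewrite ltxx.
  by rewrite (support_itv sf flt) (support_itv g0s g0lt); exact: two_chain_itv.
have Gt : G t.
  apply: gen_min tAB; first exact: gen_subgroupP.
  by move=> _ [->|->]; [rewrite /A -f2|]; exact: genX.
(* f0 and g0 agree on the support of t, so g0^-1 f0 fixes it pointwise. *)
have zt : commute t (g0^-1 * f0)%g.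
  apply: (commute_supp ts) => x xI; rewrite actM -fg ?actK //.
  by move: xI; lra.
(* g0^-1 f is (g0^-1 f0) y: the first factor centralizes t, and y conjugates t as u does. *)
have uE : [~ t, g0^-1 * f]%g = [~ t, u]%g.
  have tz : (t ^ (g0^-1 * f0) = t)%g by apply/conjg_fixP/commgP.
  by rewrite /f mulgA /commg conjgM tz yt //; exact: sub.
have Gs : G (shift_glue t j x0 (pair_seq (rho h1) (rho h2))).
  rewrite -(commg_stair tx0 tr) // -/st -/u -uE.
  by apply: genR => //; apply: genM => //; exact: genV.
(* The map to F is the first coordinate of the map to P, which sends h1, h2 to [F_a], [F_b]. *)
have [theta theta_inj theta_range] := glued_pair_embedding tx0 tr
  (rho_supp h1) (rho_supp h2) Hgen (chi := fst \o phi) (congr1 fst phi1)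
  (congr1 fst phi2) rho_inj rho_supp erefl erefl.
exists theta; split=> //; apply: subset_trans theta_range _.
by apply: gen_min => [|_ [->|->]] //; exact: gen_subgroupP.
Qed.
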